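(* Let $W$ be a finite Coxeter group, $\mathbb{K}$ a field of characteristic $0$, and $M_1=M_1(W)$ the Borel submonoid of the biHecke monoid. The quiver of $\mathbb{K}M_1$ is the graph with $W$ as vertex set and one edge $(x,z)$ for each pair $x,z\in W$ such that $x>_Bz$, $x\not>_Lz$, and $x,z$ admit no non-trivial intermediate factor $y\in W$. Each such edge can be associated with the element $q:=e_xe_z$ of the monoid $M_1$. In particular, the quiver of $\mathbb{K}M_1$ is acyclic, and every cover $x\succ_Bz$ in Bruhat order which is not a cover in left order contributes one edge to the quiver.
   Context: $W=\langle s_i\mid i\in I\rangle$ is a finite Coxeter group with identity $1$, length $\ell$ and longest element $w_0$; $D_R(w)=\{i:\ell(ws_i)<\ell(w)\}$. $\le_B$ is Bruhat order; left weak order is $u\le_Lw$ iff $\ell(w)=\ell(u)+\ell(wu^{-1})$. $[\cdot,\cdot]_B$ and $[\cdot,\cdot]_L$ denote intervals. The biHecke monoid $M(W)$ is the monoid of functions $W\to W$, acting on the right, generated by all $\pi_i,\overline\pi_i$ ($i\in I$), where $w.\pi_i=w$ if $i\in D_R(w)$ and $ws_i$ otherwise; $w.\overline\pi_i=ws_i$ if $i\in D_R(w)$ and $w$ otherwise. $M_1(W)=\{f\in M(W)\mid 1.f=1\}$. For a reduced word $i_1\cdots i_k$ of $w$, $\pi_w=\pi_{i_1}\cdots\pi_{i_k}$ and $\overline\pi_w=\overline\pi_{i_1}\cdots\overline\pi_{i_k}$. For $w\in W$, $e_w:=\pi_{w^{-1}w_0}\overline\pi_{w_0w}\in M_1$;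 it is the unique idempotent of $M(W)$ with $1.e_w=1$ and $w_0.e_w=w$. The simple $\mathbb{K}M_1$-modules are one-dimensional and indexed by $W$: the one indexed by $w$ has basis $\epsilon_w$ with $\epsilon_w.f=\epsilon_w$ if $w.f=w$ and $0$ otherwise. The vertex $w$ of the quiver corresponds to this module; the number of edges $(x,z)$ is $\dim\varepsilon_x(\operatorname{rad}/\operatorname{rad}^2)\varepsilon_z$, where $\varepsilon_x,\varepsilon_z$ are primitive idempotents of $\mathbb{K}M_1$ corresponding to $x,z$. For $x,z\in W$ with $x>_Bz$, an element $y\in W$ is an intermediate factor for $x,z$ if $[1,y]_L\cap[c,a]_B\ne\emptyset$ for all $a\in[1,x]_L$ and $c\in[1,z]_L$ with $c\le_Ba$. It is a non-trivial intermediate factor if moreover $x>_By>_Bz$ and $y\not>_Lz$. *)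

(* Defs.v *)
From HB Require Import structures.
From mathcomp Require Import all_boot all_order all_fingroup all_algebra all_field.
From mathcomp Require Import boolp.

Set Implicit Arguments.
Unset Strict Implicit.
Unset Printing Implicit Defensive.

Import GRing.Theory.

Local Open Scope group_scope.

(* A finite group W with the Coxeter presentation
   < s_i | (s_i s_j)^(m_ij) = 1 >.  The value m_ij = 0 encodes m_ij = oo: the
   relation x ^+ 0 = 1 is void.  [cox_univ] is the universal property of the
   presentation; uniqueness of phi follows from [cox_span]. *)
Record coxeterGroup := CoxeterGroup {
  cox_sort :> finGroupType;
  cox_index : finType;
  cox_gen : cox_index -> cox_sort;
  cox_mx : cox_index -> cox_index -> nat;
  cox_mx_sym : forall i j, cox_mx i j = cox_mx j i;
  cox_mx_eq1 : forall i j, (cox_mx i j == 1%N) = (i == j);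
  cox_span : <<[set cox_gen i | i : cox_index]>> = [set: cox_sort];
  cox_rel : forall i j, (cox_gen i * cox_gen j) ^+ cox_mx i j = 1;
  cox_univ : forall (H : groupType) (t : cox_index -> H),
    (forall i j, (t i * t j) ^+ cox_mx i j = 1) ->
    exists phi : cox_sort -> H,
      {morph phi : x y / x * y} /\ (forall i, phi (cox_gen i) = t i)
}.

Arguments cox_gen {c} i.

Section CoxeterCombinatorics.

Variable W : coxeterGroup.
Local Notation I := (cox_index W).
Local Notation s := (@cox_gen W).
Implicit Types (u v w x y z : W) (r : seq I).

Definition word_val r : W := \prod_(i <- r) s i.

Lemma word_ex w : exists n, [exists r : n.-tuple I, word_val r == w].
Proof.
have: w \in <<[set s i | i : I]>> by rewrite cox_span inE.
case/gen_prodgP=> n [c cP ->].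
have /fin_all_exists [f fP]: forall k, exists i, c k = s i.
  by move=> k; have /imsetP[i _ ->] := cP k; exists i.
exists n; apply/existsP; exists [tuple f k | k < n].
rewrite /word_val big_tuple; apply/eqP/eq_bigr => k _.
by rewrite tnth_mktuple fP.
Qed.

Definition len w : nat := ex_minn (word_ex w).

Definition reduced r w := (word_val r == w) && (size r == len w).

Lemma reduced_ex w : exists r, reduced r w.
Proof.
rewrite /reduced /len; case: ex_minnP => n /existsP[r rw] _.
by exists r; rewrite rw size_tuple /=.
Qed.

Definition redword w : seq I := xchoose (reduced_ex w).

Definition w0 : W := [arg max_(w > 1) len w].

Definition descR w : {set I} := [set i | len (w * s i) < len w].

Definition reflections : {set W} := [set s i ^ w | i : I, w : W].

Definition bruhat_step u v := (len u < len v) && (u^-1 * v \in reflections).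
Definition leB : rel W := connect bruhat_step.
Definition ltB u v := (u != v) && leB u v.

Definition leL u v := len v == (len u + len (v * u^-1))%N.
Definition ltL u v := (u != v) && leL u v.

Definition intvB u v : {set W} := [set t | leB u t && leB t v].
Definition intvL u v : {set W} := [set t | leL u t && leL t v].

Definition coverB x z := ltB z x && ~~ [exists y, ltB z y && ltB y x].
Definition coverL x z := ltL z x && ~~ [exists y, ltL z y && ltL y x].

Definition intermediate x z y :=
  [forall a in intvL 1 x, forall c in intvL 1 z,
     leB c a ==> (intvL 1 y :&: intvB c a != set0)].

Definition nontrivial_intermediate x z y :=
  [&& intermediate x z y, ltB y x, ltB z y & ~~ ltL z y].

Definition quiver_pair x z :=
  [&& ltB z x, ~~ ltL z x & ~~ [exists y, nontrivial_intermediate x z y]].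

End CoxeterCombinatorics.

(* The monoid of self-maps of T acting on the right: f * g is "f, then g". *)
Definition transf (T : finType) := {ffun T -> T}.

Section Transf.

Variable T : finType.

HB.instance Definition _ := Finite.on (transf T).

Definition transf_one : transf T := [ffun w => w].
Definition transf_mul (f g : transf T) : transf T := [ffun w => g (f w)].

Fact transf_mulA : associative transf_mul.
Proof. by move=> f g h; apply/ffunP=> w; rewrite !ffunE. Qed.
Fact transf_mul1 : left_id transf_one transf_mul.
Proof. by move=> f; apply/ffunP=> w; rewrite !ffunE. Qed.
Fact transf_mulr1 : right_id transf_one transf_mul.
Proof. by move=> f; apply/ffunP=> w; rewrite !ffunE. Qed.

HB.instance Definition _ :=
  isMonoid.Build (transf T) transf_mulA transf_mul1 transf_mulr1.

Definition submonoid_set (B : {set transf T}) :=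
  (1 \in B) && [forall f in B, forall g in B, f * g \in B].

Definition gen_submonoid (A : {set transf T}) : {set transf T} :=
  \bigcap_(B : {set transf T} | submonoid_set B && (A \subset B)) B.

End Transf.

Section BiHecke.

Variable W : coxeterGroup.
Implicit Types w : W.

Definition pi_gen (i : cox_index W) : transf W :=
  [ffun w => if i \in descR w then w else w * cox_gen i].
Definition pib_gen (i : cox_index W) : transf W :=
  [ffun w => if i \in descR w then w * cox_gen i else w].

Definition biHecke : {set transf W} :=
  gen_submonoid ([set pi_gen i | i : cox_index W]
                   :|: [set pib_gen i | i : cox_index W]).

(* Independent of the reduced word chosen: both families satisfy the braid
   relations. *)
Definition pi_ w : transf W := \prod_(i <- redword w) pi_gen i.
Definition pib_ w : transf W := \prod_(i <- redword w) pib_gen i.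

Definition e_ w : transf W := pi_ (w^-1 * w0 W) * pib_ (w0 W * w).

Definition borel_pred : pred (transf W) :=
  fun f => (f \in biHecke) && (f 1 == 1).

Fact borel_closed : umagma_closed borel_pred.
Proof.
have [B1 BM]: (1 : transf W) \in biHecke
    /\ {in biHecke &, forall f g, f * g \in biHecke}.
  split=> [|f g /bigcapP fB /bigcapP gB]; apply/bigcapP=> B PB;
    case/andP: (PB) => /andP[B1 /forall_inP BM] _ //.
  by move/(_ f (fB B PB))/forall_inP: BM => /(_ g (gB B PB)).
split; first by rewrite unfold_in B1 ffunE /=.
move=> f g; rewrite !unfold_in => /andP[fB /eqP f1] /andP[gB /eqP g1].
apply/andP; split; first exact: BM.
by rewrite ffunE f1 g1.
Qed.

HB.instance Definition _ := isMulClosed.Build _ borel_pred borel_closed.2.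
HB.instance Definition _ := isMul1Closed.Build _ borel_pred borel_closed.1.

Record borel := Borel { borel_val :> transf W; _ : borel_pred borel_val }.

HB.instance Definition _ := [isSub for borel_val].
HB.instance Definition _ := [Finite of borel by <:].
HB.instance Definition _ :=
  SubChoice_isSubMonoid.Build _ _ borel borel_closed.

End BiHecke.

Local Open Scope ring_scope.

(* The monoid algebra K M_1(W): an element is its family of coefficients. *)
Definition borel_alg (K : fieldType) (W : coxeterGroup) := {ffun borel W -> K^o}.

Section MonoidAlgebra.

Variables (K : fieldType) (W : coxeterGroup).
Local Notation G := (borel W).
Local Notation A := (borel_alg K W).
Implicit Types (a b c : A) (f g h : G).

HB.instance Definition _ := Vector.on A.

Definition mon f : A := [ffun g => (g == f)%:R].

Definition conv a b : A :=
  [ffun h => \sum_(f : G) \sum_(g : G | (f * g)%g == h) a f * b g].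

Fact convA : associative conv.
Proof.
move=> a b c; apply/ffunP=> h; rewrite !ffunE.
transitivity (\sum_(f : G) \sum_(g : G) \sum_(k : G | (f * (g * k))%g == h) a f * (b g * c k)).
  apply: eq_bigr => f _.
  under eq_bigr => x _ do rewrite ffunE mulr_sumr.
  rewrite exchange_big /=; apply: eq_bigr => g _.
  under eq_bigr => x _ do rewrite mulr_sumr.
  rewrite (exchange_big_dep xpredT) //= [RHS]big_mkcond.
  apply: eq_bigr => k _.
  rewrite (eq_bigl (fun x => (x == g * k)%g && ((f * x)%g == h))) => [|x].
    by rewrite big_mkcondr big_pred1_eq.
  by rewrite andbC eq_sym.
transitivity (\sum_(x : G) \sum_(f : G) \sum_(g : G | (f * g)%g == x)
                \sum_(k : G | (x * k)%g == h) a f * b g * c k).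
  rewrite [RHS]exchange_big /=; apply: eq_bigr => f _.
  rewrite [RHS](exchange_big_dep xpredT) //=; apply: eq_bigr => g _.
  rewrite [RHS](big_pred1 (f * g)%g) => [|x]; last by rewrite /= eq_sym.
  by apply: eq_big => [k|k _]; rewrite ?mulgA ?mulrA.
apply: eq_bigr => x _; apply: esym.
under eq_bigr => k _ do rewrite ffunE mulr_suml.
rewrite exchange_big /=; apply: eq_bigr => f _.
under eq_bigr => k _ do rewrite mulr_suml.
by rewrite exchange_big.
Qed.

Fact conv1l : left_id (mon 1%g) conv.
Proof.
move=> a; apply/ffunP=> h; rewrite ffunE (bigD1 (1%g : G)) //= [X in _ + X]big1.
  rewrite addr0 (big_pred1 h) => [|g]; last by rewrite /= mul1g.
  by rewrite ffunE eqxx mul1r.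
by move=> f /negPf f1; rewrite big1 // => g _; rewrite ffunE f1 mul0r.
Qed.

Fact conv1r : right_id (mon 1%g) conv.
Proof.
move=> a; apply/ffunP=> h; rewrite ffunE (bigD1 h) //= [X in _ + X]big1.
  rewrite addr0 (bigD1 (1%g : G)) ?mulg1 //= big1 => [|g /andP[_ /negPf g1]].
    by rewrite ffunE eqxx mulr1 addr0.
  by rewrite ffunE g1 mulr0.
move=> f /negPf fh; rewrite big1 // => g /eqP fg; rewrite ffunE.
by case: eqP fg => [->|]; rewrite ?mulr0 // mulg1 => /eqP; rewrite fh.
Qed.

Fact convDl : left_distributive conv +%R.
Proof.
move=> a b c; apply/ffunP=> h; rewrite !ffunE -big_split /=.
apply: eq_bigr => f _; rewrite -big_split; apply: eq_bigr => g _.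
by rewrite ffunE mulrDl.
Qed.

Fact convDr : right_distributive conv +%R.
Proof.
move=> a b c; apply/ffunP=> h; rewrite !ffunE -big_split /=.
apply: eq_bigr => f _; rewrite -big_split; apply: eq_bigr => g _.
by rewrite ffunE mulrDr.
Qed.

Fact mon1_neq0 : mon 1%g != 0.
Proof.
by apply/eqP=> /ffunP/(_ 1%g)/eqP; rewrite !ffunE eqxx oner_eq0.
Qed.

HB.instance Definition _ :=
  GRing.Zmodule_isNzRing.Build A convA conv1l conv1r convDl convDr mon1_neq0.

Fact conv_scalel (k : K) a b : k *: (a * b) = (k *: a) * b.
Proof.
apply/ffunP=> h; rewrite !ffunE scaler_sumr; apply: eq_bigr => f _.
by rewrite scaler_sumr; apply: eq_bigr => g _; rewrite ffunE scalerAl.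
Qed.

HB.instance Definition _ := GRing.Lmodule_isLalgebra.Build K A conv_scalel.

Fact conv_scaler (k : K) a b : k *: (a * b) = a * (k *: b).
Proof.
apply/ffunP=> h; rewrite !ffunE scaler_sumr; apply: eq_bigr => f _.
by rewrite scaler_sumr; apply: eq_bigr => g _; rewrite ffunE scalerAr.
Qed.

HB.instance Definition _ := GRing.Lalgebra_isAlgebra.Build K A conv_scaler.
HB.instance Definition _ := Algebra_isFalgebra.Build K A.

End MonoidAlgebra.

Section Radical.

Variables (K : fieldType) (A : falgType K).
Implicit Types (a b e f g : A) (J : {vspace A}).

Definition right_ideal J := (J * fullv <= J)%VS.

Definition maximal_right_ideal J :=
  [/\ right_ideal J, J != fullv &
      forall J', right_ideal J' -> (J <= J')%VS -> J' = J \/ J' = fullv].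

Lemma jacobson_ex : exists J,
  forall a, a \in J <-> (forall m, maximal_right_ideal m -> a \in m).
Proof.
pose P n := `[< exists2 s : seq {vspace A},
  (forall m, m \in s -> maximal_right_ideal m) &
  \dim (\bigcap_(m <- s) m)%VS = n >].
have exP : exists n, P n by exists (\dim {:A}); apply/asboolP; exists [::];
  rewrite ?big_nil.
case: (ex_minnP exP) => n /asboolP[s sP sn] minn.
exists (\bigcap_(m <- s) m)%VS => a; split=> [aJ m mP|aP].
  have: (n <= \dim (\bigcap_(m <- m :: s) m)%VS)%N.
    apply: minn; apply/asboolP; exists (m :: s) => // m'.
    by rewrite inE => /orP[/eqP->|/sP].
  rewrite big_cons -sn => le_n.
  have /eqP eqJ : (m :&: \bigcap_(m <- s) m == \bigcap_(m <- s) m)%VS.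
    by rewrite eqEdim capvSr.
  by move: aJ; rewrite -eqJ memv_cap => /andP[].
elim: s sP {sn} => [|m s IH] sP; first by rewrite big_nil memvf.
rewrite big_cons memv_cap aP ?IH //; last by apply: sP; rewrite mem_head.
by move=> m' m's; apply: sP; rewrite inE m's orbT.
Qed.

(* The Jacobson radical: the intersection of all maximal right ideals. *)
Definition jacobson : {vspace A} := projT1 (cid jacobson_ex).

Definition primitive_idempotent e :=
  [/\ e != 0, e * e = e &
      forall f g, f * f = f -> g * g = g -> f * g = 0 -> g * f = 0 ->
        e = f + g -> f = 0 \/ g = 0].

(* For an idempotent e and a one-dimensional right module K with a acting as
   the scalar chi a: phi induces an isomorphism e A / e rad -> K of right
   A-modules, i.e. K is the top of the projective module e A. *)
Definition top_is (chi : A -> K) e :=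
  exists phi : {linear A -> K^o},
    [/\ forall a b, phi (e * a * b) = phi (e * a) * chi b,
        phi e != 0 &
        forall a, phi (e * a) = 0 <-> e * a \in (<[e]> * jacobson)%VS].

(* Write rad for [jacobson].  e (rad / rad^2) f is the image of e rad f in
   A / rad^2; [arrow_space e f] is the preimage of this image in A. *)
Definition arrow_space e f : {vspace A} :=
  (<[e]> * jacobson * <[f]> + jacobson * jacobson)%VS.

Definition nb_arrows e f : nat :=
  (\dim (arrow_space e f) - \dim (jacobson * jacobson)%VS)%N.

End Radical.

Arguments jacobson {K} A.

Section BorelAlgebra.

Variables (W : coxeterGroup) (K : fieldType).

(* The scalar by which a acts on the simple right module with basis epsilon_w,
   where epsilon_w . f = epsilon_w if w . f = w and 0 otherwise. *)
Definition simple_char (w : W) (a : borel_alg K W) : K :=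
  \sum_(f : borel W | borel_val f w == w) a f.

Definition corresponds_to (w : W) (e : borel_alg K W) :=
  primitive_idempotent e /\ top_is (simple_char w) e.

End BorelAlgebra.

(* Main.v *)
(* The paper goes through the theory of J-trivial monoids; here the arrows are
   counted as derivations.  The radical J is the common kernel of the
   characters chi_w, and the dual of eps_x (J / J^2) eps_z consists of the
   linear maps D with D(f g) = chi_x(f) D(g) + chi_z(g) D(f), modulo the inner
   ones.  As M_1 is generated by the idempotents e_w, where u.e_w is the
   Bruhat-maximum of [1,u]_B n [1,w]_L and chi_w(e_v) = 1 iff w <=_L v, such a
   D is determined by its values on the e_w.  These are D(e_x) or D(e_z) if
   exactly one of x <=_L w, z <=_L w holds, and 0 otherwise.  Hence, up to inner
   derivations, D is determined by D(e_x e_z), which must vanish unless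
   quiver_pair holds: y is an intermediate factor iff
   e_x e_y e_z = e_x e_z.  Conversely, when quiver_pair holds, the function
   equal to 1 at the f with x.f <> x and e_x f e_z = e_x e_z, and to 0
   elsewhere, is such a derivation.

   On the Coxeter side the exchange property is replaced by the cocycle of the
   action of W on W x {+1, -1}, which [cox_univ] provides. *)

From HB Require Import structures.
Require Import Defs.
From mathcomp Require Import all_boot all_order all_fingroup all_algebra all_field.
From mathcomp Require Import boolp zify ring.

Set Implicit Arguments.
Unset Strict Implicit.
Unset Printing Implicit Defensive.

Import GRing.Theory.
Local Open Scope group_scope.

(** * Words and length in a Coxeter group *)

Section Coxeter.
Variable W : coxeterGroup.
Local Notation I := (cox_index W).
Local Notation s := (@cox_gen W).
Local Notation T := (reflections W).
Implicit Types (u v w x y z t g : W) (i j : I) (r : seq I) (f h : transf W).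

(* [mulgA] and [invMg] restated with the multiplication elaborated at [W]:
   rewriting with the generic lemmas leaves a convertible but syntactically
   different instance, which [lia] does not identify. *)
Lemma cox_mulA u v w : u * (v * w) = u * v * w. Proof. exact: mulgA. Qed.
Lemma cox_invM u v : (u * v)^-1 = v^-1 * u^-1. Proof. exact: invMg. Qed.

Lemma gen_sq i : s i * s i = 1.
Proof.
have /eqP mi1 : cox_mx i i == 1%N by rewrite cox_mx_eq1.
by have := cox_rel i i; rewrite mi1 expg1.
Qed.

Lemma cox_genV i : (s i)^-1 = s i.
Proof. by apply/eqP; rewrite eq_invg_mul gen_sq. Qed.

Lemma gen_mulK i w : s i * (s i * w) = w.
Proof. by rewrite mulgA gen_sq mul1g. Qed.

Lemma mul_genK i w : w * s i * s i = w.
Proof. by rewrite -mulgA gen_sq mulg1. Qed.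

Lemma len_word_val r : len (word_val r) <= size r.
Proof.
rewrite /len; case: ex_minnP => n _ /(_ (size r)); apply.
by apply/existsP; exists (in_tuple r).
Qed.

Lemma redwordP w : word_val (redword w) = w /\ size (redword w) = len w.
Proof. by have /andP[/eqP-> /eqP->] := xchooseP (reduced_ex w). Qed.

Lemma word_val_cons i r : word_val (i :: r) = s i * word_val r.
Proof. by rewrite /word_val big_cons. Qed.

Lemma word_val_cat r1 r2 : word_val (r1 ++ r2) = word_val r1 * word_val r2.
Proof. by rewrite /word_val big_cat. Qed.

Lemma word_val_nil : word_val [::] = 1 :> W.
Proof. by rewrite /word_val big_nil. Qed.

Lemma word_val_seq1 i : word_val [:: i] = s i.
Proof. by rewrite /word_val big_seq1. Qed.

Lemma word_val_rev r : word_val (rev r) = (word_val r)^-1.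
Proof.
elim: r => [|i r IH]; first by rewrite word_val_nil invg1.
by rewrite rev_cons -cats1 word_val_cat word_val_seq1 word_val_cons invMg IH cox_genV.
Qed.

Lemma len1 : len (1 : W) = 0%N.
Proof. by apply/eqP; rewrite -leqn0 -word_val_nil len_word_val. Qed.

Lemma len_mul u v : len (u * v) <= len u + len v.
Proof.
have [eu <-] := redwordP u; have [ev <-] := redwordP v.
by rewrite -{1}eu -{1}ev -word_val_cat -size_cat len_word_val.
Qed.

Lemma len_inv w : len w^-1 = len w.
Proof.
suff le_len v : len v^-1 <= len v by apply/eqP; rewrite eqn_leq -{3}[w]invgK !le_len.
have [ev <-] := redwordP v.
by rewrite -{1}ev -word_val_rev -size_rev len_word_val.
Qed.

Lemma len_eq0 w : (len w == 0%N) = (w == 1).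
Proof.
apply/eqP/eqP => [w0|->]; last exact: len1.
have [ew /eqP] := redwordP w; rewrite w0 => /nilP re.
by rewrite -ew re word_val_nil.
Qed.

Lemma len_gen_le i : len (s i) <= 1.
Proof. by rewrite -word_val_seq1 len_word_val. Qed.

Lemma len_genM_le i w : len (s i * w) <= (len w).+1.
Proof. by apply: leq_trans (len_mul _ _) _; rewrite -add1n leq_add2r len_gen_le. Qed.

(** Deleting the first letter of a reduced word leaves a reduced word. *)
Lemma len_ind (P : W -> Prop) : P 1 ->
  (forall i w, len (s i * w) = (len w).+1 -> P w -> P (s i * w)) ->
  forall w, P w.
Proof.
move=> P1 PS w; have [] := redwordP w.
move: (redword w) => r; elim: r w => [|i r IH] w; first by rewrite word_val_nil => <-.
rewrite word_val_cons => ew /= sz; subst w.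
have le1 := len_genM_le i (word_val r).
have le2 := len_word_val r.
have e : size r = len (word_val r).
  by apply/eqP; rewrite eqn_leq le2 -ltnS sz le1.
by apply: PS; [rewrite -sz e | apply: IH].
Qed.

(** * Reflections and the sign cocycle *)

Lemma reflectionsP t : reflect (exists i w, t = s i ^ w) (t \in T).
Proof.
apply: (iffP imset2P) => [[i w _ _ ->]|[i [w ->]]]; first by exists i, w.
by exists i w.
Qed.

Lemma gen_reflection i : s i \in T.
Proof. by apply/reflectionsP; exists i, 1; rewrite conjg1. Qed.

Lemma reflectionJ t w : t \in T -> t ^ w \in T.
Proof.
case/reflectionsP => i [u ->]; apply/reflectionsP.
by exists i, (u * w); rewrite conjgM.
Qed.

Lemma reflection_sq t : t \in T -> t * t = 1.
Proof. by case/reflectionsP => i [w ->]; rewrite -conjMg gen_sq conj1g. Qed.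

Lemma reflectionV t : t \in T -> t^-1 = t.
Proof. by move/reflection_sq => tt; apply/eqP; rewrite eq_invg_mul tt. Qed.

(** The boolean is a sign, with [addb] as product: s_i conjugates t and flips the sign exactly at t
    = s_i. All of W takes the place of the set of reflections, which avoids a subtype. *)
Definition cocycle_step i (p : W * bool) : W * bool :=
  (p.1 ^ s i, p.2 (+) (p.1 == s i)).

Lemma conj_gen_eq t i : (t ^ s i == s i) = (t == s i).
Proof. by rewrite -[RHS](inj_eq (conjg_inj (s i))) [s i ^ _]conjgE mulKg. Qed.

Lemma cocycle_stepK i : involutive (cocycle_step i).
Proof.
case=> t b; rewrite /cocycle_step /= -conjgM gen_sq conjg1 conj_gen_eq.
by rewrite addbK.
Qed.

Definition cocycle_perm i := perm (inv_inj (cocycle_stepK i)).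

Lemma gen_dihedral i j n :
  s i * (s i * s j) ^- n = (s i * s j) ^+ n * s i.
Proof.
have: ((s i * s j) ^+ n) ^ s i = (s i * s j) ^- n.
  by rewrite conjXg conjgE cox_genV -!mulgA gen_mulK -expVgn invMg !cox_genV.
by move=> <-; rewrite conjgE cox_genV gen_mulK.
Qed.

Lemma conj_eqV t u w : (t ^ w == u) = (t == w * u * w^-1).
Proof. by rewrite -(inj_eq (conjg_inj w^-1)) conjgK [u ^ _]conjgE invgK mulgA. Qed.

(** Along the alternating word of length 2n, the sign flips at letter l exactly when t is the
    dihedral reflection (s_i s_j)^l s_i. *)
Lemma cocycle_perm_exp i j n t b :
  ((cocycle_perm i * cocycle_perm j) ^+ n) (t, b) =
    (t ^ ((s i * s j) ^+ n),
     b (+) \big[addb/false]_(0 <= l < n.*2) (t == (s i * s j) ^+ l * s i)).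
Proof.
elim: n => [|n IH].
  by rewrite !expg0 perm1 conjg1 big_nil addbF.
rewrite expgSr permM IH permM !permE /cocycle_step /=.
rewrite doubleS !big_nat_recr //= !addbA -!conjgM -expgSr.
congr (_, _ (+) _ (+) _).
  by rewrite conj_eqV -mulgA gen_dihedral mulgA -expgnDr addnn.
rewrite conj_eqV invMg cox_genV mulgA -!mulgA gen_dihedral !mulgA.
by rewrite -[_ * s i * s j]mulgA -expgSr -expgnDr addSn addnn.
Qed.

(** With m = [cox_mx i j], the reflections number l and l + m coincide because (s_i s_j)^m = 1, so
    the 2m flips cancel in pairs. *)
Lemma cocycle_perm_rel i j :
  (cocycle_perm i * cocycle_perm j) ^+ cox_mx i j = 1.
Proof.
apply/permP=> -[t b]; rewrite perm1 cocycle_perm_exp cox_rel conjg1.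
set m := cox_mx i j; congr pair; rewrite -addnn (big_cat_nat (n := m)) ?leq_addr //=.
rewrite -{2}[m]add0n big_addn addnK.
under [X in _ (+) (_ (+) X)]eq_bigr => l _ do rewrite expgnDr cox_rel mulg1.
by rewrite addbb addbF.
Qed.

Lemma cocycle_ex : exists N : W -> W -> bool,
  [/\ forall i t, N (s i) t = (t == s i)
    & forall u v t, N (u * v) t = N u t (+) N v (t ^ u)].
Proof.
have [phi [phiM phis]] := cox_univ cocycle_perm_rel.
have phiE w t b : phi w (t, b) = (t ^ w, b (+) (phi w (t, false)).2).
  elim/len_ind: w t b => [|i w _ IH] t b.
    have -> : phi 1 = 1 by apply: (mulgI (phi 1)); rewrite -phiM !mulg1.
    by rewrite !perm1 conjg1 addbF.
  rewrite phiM !permM phis !permE /cocycle_step /= IH [in RHS]IH /=.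
  by rewrite conjgM addbA.
exists (fun w t => (phi w (t, false)).2); split=> [i t|u v t].
  by rewrite phis permE.
by rewrite phiM permM phiE phiE.
Qed.

(** Induction on length shows that a flip at t makes t w shorter than w. As t flips its own sign,
    [N (t * w) t] is the negation of [N w t], which gives the converse. *)
Lemma len_reflection : exists N : W -> W -> bool,
  [/\ forall i t, N (s i) t = (t == s i),
      forall u v t, N (u * v) t = N u t (+) N v (t ^ u)
    & forall t w, t \in T -> (len (t * w) < len w) = N w t].
Proof.
have [N [Ns NM]] := cocycle_ex; exists N; split=> // t w tT.
have N1 t' : N 1 t' = false.
  by have := NM 1 1 t'; rewrite mulg1 conjg1; case: (N 1 t').
have Nlt v t' : t' \in T -> N v t' -> len (t' * v) < len v.
  elim/len_ind: v t' => [|i v lv IH] t' t'T; first by rewrite N1.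
  rewrite NM Ns; case: eqP => [-> _|/eqP ti].
    by rewrite gen_mulK lv.
  move/(IH _ (reflectionJ _ t'T)); rewrite lv !conjgE cox_genV => lt.
  have -> : t' * (s i * v) = s i * (s i * (t' * s i) * v).
    by rewrite !mulgA gen_sq mul1g.
  exact: leq_trans (len_genM_le _ _) lt.
(* With t = u^-1 s_i u, the flips coming from u^-1 and from u cancel, and s_i contributes one. *)
have NTT : N t t.
  case/reflectionsP: tT => i [u ->].
  have := NM u^-1 u (s i ^ u); rewrite mulVg N1 conjgK => e.
  rewrite {1}[s i ^ u]conjgE NM NM conjgK Ns eqxx [s i ^ s i]conjgE mulKg.
  by case: (N u^-1 _) e; case: (N u (s i)).
apply/idP/idP => [lt|]; last exact: Nlt.
apply: contraLR lt => nN; rewrite -leqNgt ltnW //.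
have := Nlt (t * w) t tT; rewrite mulgA reflection_sq // mul1g; apply.
by rewrite NM NTT conjgE mulKg (negPf nN).
Qed.
(** This takes the place of the sign character: [N] has different values for w and s_i w at s_i, so
    s_i shortens exactly one of them. *)
Lemma len_genM_neq i w : len (s i * w) != len w.
Proof.
have [N [Ns NM Nlen]] := len_reflection.
have := Nlen _ w (gen_reflection i); have := Nlen _ (s i * w) (gen_reflection i).
rewrite gen_mulK NM Ns eqxx conjgE mulKg.
by case: (N w (s i)); case: ltngtP.
Qed.

Lemma len_gen i : len (s i) = 1%N.
Proof. by have := len_genM_neq i 1; have := len_gen_le i; rewrite mulg1 len1; lia. Qed.

Lemma len_Mgen_le i w : len (w * s i) <= (len w).+1.
Proof. by rewrite -len_inv invMg cox_genV -(len_inv w) len_genM_le. Qed.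

Lemma len_Mgen_neq i w : len (w * s i) != len w.
Proof. by rewrite -len_inv invMg cox_genV -(len_inv w) len_genM_neq. Qed.

Variant gen_spec i w : bool -> Prop :=
  | GenDesc of len w = (len (w * s i)).+1 : gen_spec i w true
  | GenAsc of len (w * s i) = (len w).+1 : gen_spec i w false.

Lemma genP i w : gen_spec i w (i \in descR w).
Proof.
have lt1 := len_Mgen_le i w; have := len_Mgen_le i (w * s i).
rewrite mul_genK inE => lt2; have := len_Mgen_neq i w.
by case: ltngtP => // lt _; constructor; apply/eqP; rewrite eqn_leq ?lt1 ?lt2 ?lt.
Qed.

Lemma descR_genM i w : (i \in descR (w * s i)) = (i \notin descR w).
Proof.
case: (genP i w) => e; case: (genP i (w * s i)) => //; rewrite mul_genK e => /eqP.
  by rewrite -[X in X == _]addn0 -addn2 eqn_add2l.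
by rewrite -[X in X == _]addn0 -addn2 eqn_add2l.
Qed.

(** * Bruhat order *)

Lemma bruhat_stepP u v :
  reflect (exists2 t, t \in T & v = u * t /\ len u < len v) (bruhat_step u v).
Proof.
apply: (iffP andP) => [[lt tT]|[t tT [-> lt]]]; last by rewrite lt mulKg.
by exists (u^-1 * v); rewrite // mulKVg.
Qed.

(** By the cocycle identity, right multiplication of u and u t by s_i can reverse which of the two
    is longer only if t = s_i. All monotonicity in Bruhat order rests on this. *)
Lemma bruhat_step_gen i u v : bruhat_step u v ->
  u * s i = v \/ bruhat_step (u * s i) (v * s i).
Proof.
case/bruhat_stepP => t tT [-> lt]; case: (t =P s i) => [->|/eqP ti]; first by left.
right; apply/bruhat_stepP; exists (t ^ s i); first exact: reflectionJ.
split; first by rewrite conjgE cox_genV !mulgA mul_genK.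
have [N [Ns NM Nlen]] := len_reflection.
have := Nlen t (u * t)^-1 tT.
rewrite len_inv invMg (reflectionV tT) mulgA (reflection_sq tT) mul1g len_inv lt => Nt.
have := Nlen (t ^ s i) (s i * (t * u^-1)) (reflectionJ _ tT).
rewrite NM Ns -conjgM gen_sq conjg1 -Nt conj_gen_eq (negPf ti) conjgE cox_genV.
rewrite -!mulgA gen_mulK [t * (t * _)]mulgA (reflection_sq tT) mul1g.
rewrite -len_inv -[X in _ < X]len_inv !invMg cox_genV invgK mulgA.
by rewrite (reflectionV tT).
Qed.

Lemma leB_refl u : leB u u. Proof. exact: connect0. Qed.

Lemma leB_trans v u w : leB u v -> leB v w -> leB u w.
Proof. exact: connect_trans. Qed.

Lemma bruhat_step_leB u v : bruhat_step u v -> leB u v.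
Proof. exact: connect1. Qed.

Lemma leB_homo (k : W -> W) :
  (forall u v, bruhat_step u v -> leB (k u) (k v)) ->
  forall u v, leB u v -> leB (k u) (k v).
Proof.
move=> kP u v /connectP[p]; elim: p u => [|y p IH] u /= => [_ ->|]; first exact: leB_refl.
by case/andP=> /kP uy pp vE; apply: leB_trans uy (IH _ pp vE).
Qed.

Lemma leB_len u v : leB u v -> u = v \/ len u < len v.
Proof.
case/connectP=> p; elim: p u => [|y p IH] u /= => [_ ->|]; first by left.
case/andP=> /andP[uy _] pp vE; right.
by case: (IH _ pp vE) => [<- //|]; apply: ltn_trans.
Qed.

Lemma leB_len_le u v : leB u v -> len u <= len v.
Proof. by case/leB_len => [->|/ltnW]. Qed.

Lemma leB_anti u v : leB u v -> leB v u -> u = v.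
Proof.
by move=> /leB_len[//|lt] /leB_len_le; rewrite leqNgt lt.
Qed.

Lemma ltB_len u v : ltB u v -> len u < len v.
Proof. by case/andP=> uv /leB_len[e|//]; rewrite e eqxx in uv. Qed.

Lemma bruhat_step_Mgen i w : len w < len (w * s i) -> bruhat_step w (w * s i).
Proof. by move=> lt; rewrite /bruhat_step lt mulKg gen_reflection. Qed.

Lemma leB_inv u v : leB u v -> leB u^-1 v^-1.
Proof.
apply: leB_homo => {}u {}v /bruhat_stepP[t tT [e lt]].
apply: bruhat_step_leB; apply/bruhat_stepP; exists (t ^ u^-1); first exact: reflectionJ.
by rewrite !len_inv e invMg (reflectionV tT) conjgE invgK !mulgA mulVg mul1g -e.
Qed.

Lemma pi_genE i w : pi_gen i w = if i \in descR w then w else w * s i.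
Proof. by rewrite ffunE. Qed.

Lemma pib_genE i w : pib_gen i w = if i \in descR w then w * s i else w.
Proof. by rewrite ffunE. Qed.

Lemma leB_pi_gen i w : leB w (pi_gen i w) /\ leB (w * s i) (pi_gen i w).
Proof.
rewrite pi_genE; case: genP => e; split; rewrite ?leB_refl //.
  rewrite -{2}[w](mul_genK i); apply/bruhat_step_leB/bruhat_step_Mgen.
  by rewrite mul_genK e.
by apply/bruhat_step_leB/bruhat_step_Mgen; rewrite e.
Qed.

Lemma leB_pib_gen i w : leB (pib_gen i w) w /\ leB (pib_gen i w) (w * s i).
Proof.
have [le1 le2] := leB_pi_gen i w.
move: le1 le2; rewrite pib_genE pi_genE.
by case: ifP; rewrite ?leB_refl.
Qed.

Lemma pi_gen_leB i u v : leB u v -> leB (pi_gen i u) (pi_gen i v).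
Proof.
apply: leB_homo => {}u {}v uv.
have [v1 v2] := leB_pi_gen i v; have uvB := bruhat_step_leB uv.
rewrite [pi_gen i u]pi_genE; case: ifP => _; first exact: leB_trans v1.
by case: (bruhat_step_gen i uv) => [-> //|/bruhat_step_leB/leB_trans]; apply.
Qed.

Lemma pib_gen_leB i u v : leB u v -> leB (pib_gen i u) (pib_gen i v).
Proof.
apply: leB_homo => {}u {}v uv.
have [u1 u2] := leB_pib_gen i u; have uvB := bruhat_step_leB uv.
rewrite [pib_gen i v]pib_genE; case: ifP => _; last exact: leB_trans uvB.
case: (bruhat_step_gen i uv) => [<-|/bruhat_step_leB]; first by rewrite mul_genK.
exact: leB_trans.
Qed.

(** * Left order *)

Lemma leL_refl u : leL u u.
Proof. by rewrite /leL mulgV len1 addn0. Qed.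

Lemma le1L u : leL 1 u.
Proof. by rewrite /leL invg1 mulg1 len1. Qed.

Lemma leL_mul g u : leL u (g * u) = (len (g * u) == len u + len g)%N.
Proof. by rewrite /leL mulgK. Qed.

Lemma leL_trans v u w : leL u v -> leL v w -> leL u w.
Proof.
move=> /eqP uv /eqP vw; rewrite /leL eqn_leq; apply/andP; split.
  by rewrite -{1}[w](mulgVK u) addnC len_mul.
rewrite vw uv -addnA leq_add2l addnC.
by rewrite (_ : w * u^-1 = w * v^-1 * (v * u^-1)) ?len_mul // !mulgA mulgVK.
Qed.

Lemma leL_len u v : leL u v -> len u <= len v.
Proof. by move/eqP->; apply: leq_addr. Qed.

Lemma leL_anti u v : leL u v -> leL v u -> u = v.
Proof.
move=> /eqP uv /leL_len; rewrite uv -{2}[len u]addn0 leq_add2l leqn0 len_eq0.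
by move/eqP/divg1_eq.
Qed.

Lemma leL_ind (P : W -> W -> Prop) u : P 1 u ->
  (forall g i, len (s i * (g * u)) = (len (g * u)).+1 -> leL u (g * u) ->
     len (s i * g) = (len g).+1 -> P g (g * u) -> P (s i * g) (s i * (g * u))) ->
  forall v, leL u v -> P (v * u^-1) v.
Proof.
move=> P1 PS v uv; rewrite -{2}[v](mulgVK u); move: uv; rewrite -{1}[v](mulgVK u).
elim/len_ind: (v * u^-1) => [|i g lg IH]; first by rewrite mul1g.
rewrite leL_mul lg -mulgA addnS => /eqP e.
have le1 := len_genM_le i (g * u); have le2 := len_mul g u.
have e2 : len (g * u) = (len u + len g)%N.
  by apply/eqP; rewrite eqn_leq addnC le2 addnC -ltnS -e le1.
by apply: PS; rewrite ?leL_mul ?e ?e2 //; apply: IH; rewrite leL_mul e2.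
Qed.

Lemma leL_genM i w : leL w (s i * w) = (len (s i * w) == (len w).+1).
Proof. by rewrite leL_mul len_gen addn1. Qed.

Lemma leL_leB u v : leL u v -> leB u v.
Proof.
move: v; apply: (leL_ind (P := fun _ v => leB u v)) => [|g i e _ _ /leB_trans].
  exact: leB_refl.
apply; apply: bruhat_step_leB; rewrite /bruhat_step e ltnSn.
by rewrite -conjgE; apply: reflectionJ; apply: gen_reflection.
Qed.

End Coxeter.

(** * The biHecke monoid *)

Section TransfTheory.
Variable T : finType.
Implicit Types (f h : transf T) (A : {set transf T}).

Lemma transf1E x : (1 : transf T) x = x. Proof. exact: ffunE. Qed.

Lemma transfME f h x : (f * h) x = h (f x). Proof. exact: ffunE. Qed.

Lemma gen_submonoid_ind A (P : transf T -> Prop) : P 1 ->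
  (forall f h, P f -> P h -> P (f * h)) -> (forall f, f \in A -> P f) ->
  forall f, f \in gen_submonoid A -> P f.
Proof.
move=> P1 PM PA f /bigcapP/(_ [set h | `[< P h >]]).
rewrite inE asboolE; apply; apply/andP; split.
  apply/andP; split; first by rewrite inE asboolE.
  apply/forall_inP => h1; rewrite inE asboolE => P1'.
  apply/forall_inP => h2; rewrite inE asboolE => P2.
  by rewrite inE asboolE; apply: PM.
by apply/subsetP => h hA; rewrite inE asboolE; apply: PA.
Qed.

Lemma gen_submonoid1 A : 1 \in gen_submonoid A.
Proof. by apply/bigcapP => B /andP[/andP[]]. Qed.

Lemma gen_submonoidM A f h :
  f \in gen_submonoid A -> h \in gen_submonoid A -> f * h \in gen_submonoid A.
Proof.
move=> /bigcapP fA /bigcapP hA; apply/bigcapP => B BP.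
have /andP[/andP[_ /forall_inP BM] _] := BP.
by move/forall_inP: (BM _ (fA _ BP)); apply; apply: hA.
Qed.

Lemma mem_gen_submonoid A f : f \in A -> f \in gen_submonoid A.
Proof. by move=> fA; apply/bigcapP => B /andP[_ /subsetP]; apply. Qed.

End TransfTheory.

Section BiHeckeTheory.
Variable W : coxeterGroup.
Local Notation I := (cox_index W).
Local Notation s := (@cox_gen W).
Local Notation w0 := (w0 W).
Implicit Types (u v w x y z t g c : W) (i j : I) (r : seq I) (f h : transf W).

Lemma biHecke1 : 1 \in biHecke W. Proof. exact: gen_submonoid1. Qed.

Lemma biHeckeM f h : f \in biHecke W -> h \in biHecke W -> f * h \in biHecke W.
Proof. exact: gen_submonoidM. Qed.

Lemma biHecke_pi i : pi_gen i \in biHecke W.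
Proof. by apply: mem_gen_submonoid; rewrite inE imset_f. Qed.

Lemma biHecke_pib i : pib_gen i \in biHecke W.
Proof. by apply: mem_gen_submonoid; rewrite inE imset_f ?orbT. Qed.

Lemma biHecke_ind (P : transf W -> Prop) : P 1 ->
  (forall f h, P f -> P h -> P (f * h)) ->
  (forall i, P (pi_gen i)) -> (forall i, P (pib_gen i)) ->
  forall f, f \in biHecke W -> P f.
Proof.
move=> P1 PM Pp Ppb; apply: gen_submonoid_ind => // f.
by rewrite inE => /orP[] /imsetP[i _ ->].
Qed.

Lemma biHecke_rev_ind (P : transf W -> Prop) : P 1 ->
  (forall f i, f \in biHecke W -> P f -> P (f * pi_gen i)) ->
  (forall f i, f \in biHecke W -> P f -> P (f * pib_gen i)) ->
  forall f, f \in biHecke W -> P f.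
Proof.
move=> P1 Pp Ppb f fH.
suff [_ /(_ 1 biHecke1 P1)] : f \in biHecke W /\
    forall h, h \in biHecke W -> P h -> P (h * f) by rewrite mul1g.
elim/biHecke_ind: f / fH => [|f1 f2 [H1 IH1] [H2 IH2]|i|i].
- by split=> [|h]; rewrite ?biHecke1 ?mulg1.
- split=> [|h hH Ph]; first exact: biHeckeM.
  by rewrite mulgA; apply: IH2; [apply: biHeckeM | apply: IH1].
- by split=> [|h hH Ph]; [apply: biHecke_pi | apply: Pp].
- by split=> [|h hH Ph]; [apply: biHecke_pib | apply: Ppb].
Qed.

Lemma biHecke_leB f u v : f \in biHecke W -> leB u v -> leB (f u) (f v).
Proof.
move=> fH; elim/biHecke_ind: f / fH u v => [|f h IHf IHh|i|i] u v uv.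
- by rewrite !transf1E.
- by rewrite !transfME; apply/IHh/IHf.
- exact: pi_gen_leB.
- exact: pib_gen_leB.
Qed.

(** Right multiplication by s_i can reverse the edge from w to s_j w only by swapping its ends: this
    is [bruhat_step_gen] together with a length count. *)
Lemma left_edge_gen i j w : len (s j * w) = (len w).+1 ->
  [/\ s j * w = w * s i, i \notin descR w & i \in descR (s j * w)] \/
  (i \in descR w) = (i \in descR (s j * w)) /\
    len (s j * (w * s i)) = (len (w * s i)).+1.
Proof.
rewrite cox_mulA => e; case: (genP i w) => e1; case: (genP i (s j * w)) => e2.
- by right; split=> //; apply: succn_inj; rewrite -e2 e e1.
- by have := len_genM_le j (w * s i); rewrite cox_mulA; lia.
- left; split=> //.
  have st : bruhat_step w (s j * w).
    by rewrite /bruhat_step e ltnSn -conjgE reflectionJ ?gen_reflection.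
  case: (bruhat_step_gen i st) => [//|/andP[]].
  by rewrite e1 -e e2 ltnNge leqnSn.
- by right; split=> //; rewrite e2 e e1.
Qed.

(* Along a cover [w < s_j w] of left order, an element of the biHecke monoid
   either contracts the edge or maps it to an edge with the same label. *)
Lemma biHecke_edge f j w : f \in biHecke W -> len (s j * w) = (len w).+1 ->
  f (s j * w) = f w \/
  f (s j * w) = s j * f w /\ len (s j * f w) = (len (f w)).+1.
Proof.
move=> fH; elim/biHecke_ind: f / fH w => [|f h IHf IHh|i|i] w e.
- by rewrite !transf1E; right.
- rewrite !transfME; case: (IHf w e) => [->|[-> e']]; first by left.
  exact: IHh.
- rewrite !pi_genE; case: (left_edge_gen i e) => [[-> /negPf-> ->]|[<- e']].
    by left.
  by right; case: ifP; rewrite ?cox_mulA // -cox_mulA.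
- rewrite !pib_genE; case: (left_edge_gen i e) => [[-> /negPf-> ->]|[<- e']].
    by left; rewrite mul_genK.
  by right; case: ifP; rewrite ?cox_mulA // -cox_mulA.
Qed.

(** Each edge of a saturated chain from u to v is either contracted or kept, so the image chain is
    no longer than the original. *)
Lemma biHecke_leL_len f u v : f \in biHecke W -> leL u v ->
  leL (f u) (f v) /\ len (f v) <= len (f u) + len (v * u^-1).
Proof.
move=> fH; apply: (leL_ind (P := fun g v =>
  leL (f u) (f v) /\ len (f v) <= len (f u) + len g)) => [|g i e _ lg [IH1 IH2]].
  by rewrite leL_refl leq_addr.
case: (biHecke_edge fH e) => [->|[-> e']].
  by rewrite lg addnS; split=> //; apply: leqW.
split; last by rewrite lg addnS e'.
by apply: leL_trans IH1 _; rewrite leL_genM e'.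
Qed.

Lemma biHecke_leL f u v : f \in biHecke W -> leL u v -> leL (f u) (f v).
Proof. by move=> fH /(biHecke_leL_len fH)[]. Qed.

Lemma borel_biHecke f : borel_pred f -> f \in biHecke W.
Proof. by case/andP. Qed.

Lemma borel_at1 f : borel_pred f -> f 1 = 1.
Proof. by case/andP=> _ /eqP. Qed.

Lemma borelM f h : borel_pred f -> borel_pred h -> borel_pred (f * h).
Proof. by case: (borel_closed W) => _; apply. Qed.

Lemma borel_regressive f w : borel_pred f -> leB (f w) w.
Proof.
move=> fB; have := borel_biHecke fB => fH.
elim/len_ind: w => [|j w e IH]; first by rewrite borel_at1 ?leB_refl.
have wj : leB w (s j * w) by apply: leL_leB; rewrite leL_genM e.
case: (biHecke_edge fH e) => [->|[-> e']]; first exact: leB_trans wj.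
(* For a kept edge, s_j (f w) has to be compared with s_j w. Passing to inverses turns left
   multiplication by s_j into right multiplication, where the monotone map [pi_gen j] applies. *)
have [_ le1] := leB_pi_gen j (f w)^-1.
have le2 := leB_trans le1 (pi_gen_leB j (leB_inv IH)).
move: (leB_inv le2); rewrite (pi_genE j w^-1) cox_invM cox_genV invgK.
case: genP => [e2|_]; last by rewrite cox_invM cox_genV invgK.
have : len w = (len (s j * w)).+1.
  by rewrite -[len (s j * w)]len_inv cox_invM cox_genV -e2 len_inv.
by lia.
Qed.

(** The length difference between u and w cannot grow under f, so once w is fixed, f u cannot be
    shorter than u. *)
Lemma borel_fix f u w : borel_pred f -> f w = w -> leL u w -> f u = u.
Proof.
move=> fB fw uw; have [_] := biHecke_leL_len (borel_biHecke fB) uw.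
rewrite fw; have /leB_len[//|] := borel_regressive u fB.
by move/eqP: uw; lia.
Qed.

(** * The longest element and the idempotents *)

Lemma max_len_w0 w : len w <= len w0.
Proof. by rewrite /Defs.w0; case: arg_maxnP => // v _; apply. Qed.

Lemma descR_w0 i : i \in descR w0.
Proof. by case: genP => // e; have := max_len_w0 (w0 * s i); lia. Qed.

Definition piw r : transf W := \prod_(i <- r) pi_gen i.
Definition pibw r : transf W := \prod_(i <- r) pib_gen i.

Lemma piw_nil : piw [::] = 1. Proof. by rewrite /piw big_nil. Qed.
Lemma pibw_nil : pibw [::] = 1. Proof. by rewrite /pibw big_nil. Qed.
Lemma piw_cons i r w : piw (i :: r) w = piw r (pi_gen i w).
Proof. by rewrite /piw big_cons transfME. Qed.
Lemma pibw_cons i r w : pibw (i :: r) w = pibw r (pib_gen i w).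
Proof. by rewrite /pibw big_cons transfME. Qed.

Lemma piw_biHecke r : piw r \in biHecke W.
Proof.
elim: r => [|i r IH]; first by rewrite piw_nil biHecke1.
by rewrite /piw big_cons; apply: biHeckeM; [apply: biHecke_pi | apply: IH].
Qed.

Lemma pibw_biHecke r : pibw r \in biHecke W.
Proof.
elim: r => [|i r IH]; first by rewrite pibw_nil biHecke1.
by rewrite /pibw big_cons; apply: biHeckeM; [apply: biHecke_pib | apply: IH].
Qed.

Lemma piw_up r w : len (w * word_val r) = (len w + size r)%N ->
  piw r w = w * word_val r.
Proof.
elim: r w => [|i r IH] w; first by rewrite piw_nil word_val_nil mulg1 transf1E.
rewrite word_val_cons cox_mulA piw_cons pi_genE /= => e.
have := len_mul (w * s i) (word_val r); have := len_word_val r.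
by case: genP => e1 *; [|apply: IH]; lia.
Qed.

Lemma pibw_down r w : len w = (len (w * word_val r) + size r)%N ->
  pibw r w = w * word_val r.
Proof.
elim: r w => [|i r IH] w; first by rewrite pibw_nil word_val_nil mulg1 transf1E.
rewrite word_val_cons cox_mulA pibw_cons pib_genE /= => e.
have := len_mul (w * s i * word_val r) (word_val r)^-1; rewrite mulgK len_inv.
have := len_word_val r.
by case: genP => e1 *; [apply: IH|]; lia.
Qed.

Lemma piw_w0 r : piw r w0 = w0.
Proof.
elim: r => [|i r IH]; first by rewrite piw_nil transf1E.
by rewrite piw_cons pi_genE descR_w0.
Qed.

(** The product of the pi_i along a reduced word of w preserves left order, sends 1 to w and fixes
    w0; it is applied to 1 <=_L w0. *)
Lemma leL_w0 w : leL w w0.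
Proof.
have [e sz] := redwordP w.
have := biHecke_leL (piw_biHecke (redword w)) (le1L w0).
by rewrite piw_w0 piw_up mul1g e // len1 sz.
Qed.

Lemma len_w0_mulV w : (len w + len (w0 * w^-1))%N = len w0.
Proof. by apply/esym/eqP/leL_w0. Qed.

Lemma w0_sq : w0 * w0 = 1.
Proof.
apply/eqP; rewrite -len_eq0; have := len_w0_mulV w0^-1.
by rewrite len_inv invgK; lia.
Qed.

Lemma w0V : w0^-1 = w0.
Proof. by apply/eqP; rewrite eq_invg_mul w0_sq. Qed.

Lemma len_w0_mul w : (len w + len (w0 * w))%N = len w0.
Proof. by rewrite -{2}[w]invgK -(len_inv w) len_w0_mulV. Qed.

Lemma len_mul_w0 w : len (w^-1 * w0) = len (w0 * w).
Proof. by rewrite -len_inv cox_invM invgK w0V. Qed.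

Lemma e_E w : e_ w = piw (redword (w^-1 * w0)) * pibw (redword (w0 * w)).
Proof. by []. Qed.

Lemma pibw_w0_mul w : pibw (redword (w0 * w)) w0 = w.
Proof.
have [e sz] := redwordP (w0 * w).
have ew : w0 * word_val (redword (w0 * w)) = w by rewrite e cox_mulA w0_sq mul1g.
by rewrite pibw_down ew // sz len_w0_mul.
Qed.

Lemma e_w0 w : e_ w w0 = w.
Proof. by rewrite e_E transfME piw_w0 pibw_w0_mul. Qed.

Lemma e_at1 w : e_ w 1 = 1.
Proof.
have [e1 sz1] := redwordP (w^-1 * w0); have [e2 sz2] := redwordP (w0 * w).
rewrite e_E transfME piw_up ?mul1g e1; last by rewrite sz1 len1.
have e : w^-1 * w0 * word_val (redword (w0 * w)) = 1.
  by rewrite e2 cox_mulA -(cox_mulA w^-1) w0_sq mulg1 mulVg.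
by rewrite pibw_down e // sz2 len1 len_mul_w0.
Qed.

Lemma e_self w : e_ w w = w.
Proof.
have [e sz] := redwordP (w^-1 * w0).
have ew : w * word_val (redword (w^-1 * w0)) = w0 by rewrite e mulVKg.
rewrite e_E transfME piw_up ew ?pibw_w0_mul //.
by rewrite sz len_mul_w0 len_w0_mul.
Qed.

Lemma idem_subproof : {E : W -> transf W | forall w, E w = e_ w}.
Proof. by exists (@e_ W). Qed.

(* A sealed copy of [e_]: rewriting with [transfME] would otherwise unfold
   [e_ w] into its two factors. *)
Definition idem w : transf W := sval idem_subproof w.

Lemma idemE w : idem w = e_ w. Proof. exact: (svalP idem_subproof). Qed.

Lemma idem_w0 w : idem w w0 = w. Proof. by rewrite idemE e_w0. Qed.

Lemma idem_self w : idem w w = w. Proof. by rewrite idemE e_self. Qed.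

Lemma idem_biHecke w : idem w \in biHecke W.
Proof. by rewrite idemE; apply: biHeckeM; [apply: piw_biHecke | apply: pibw_biHecke]. Qed.

Lemma idem_borel w : borel_pred (idem w).
Proof. by rewrite /borel_pred idem_biHecke idemE e_at1 eqxx. Qed.

Lemma borel_image f u : f \in biHecke W -> leL (f u) (f w0).
Proof. by move=> fH; apply: biHecke_leL fH (leL_w0 u). Qed.

Lemma idem_image w u : leL (idem w u) w.
Proof. by rewrite -{2}(idem_w0 w); apply: borel_image (idem_biHecke w). Qed.

Lemma idem_fix w u : (idem w u == u) = leL u w.
Proof.
apply/eqP/idP => [<-|]; first exact: idem_image.
exact: borel_fix (idem_borel w) (idem_self w).
Qed.

(** The map fixes c and is Bruhat-monotone. With [idem_image] and [borel_regressive], [idem w u] is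
    thus the Bruhat-maximum of the elements left-below w and Bruhat-below u. *)
Lemma idem_max w u c : leL c w -> leB c u -> leB c (idem w u).
Proof.
by rewrite -idem_fix => /eqP{2}<-; apply: biHecke_leB (idem_biHecke w).
Qed.

(** Such an f fixes everything left-below f w0, hence obeys the same maximality as the
    idempotent. *)
Lemma idem_uniq f : borel_pred f -> f (f w0) = f w0 -> f = idem (f w0).
Proof.
move=> fB ff; have fH := borel_biHecke fB; apply/ffunP => u; apply: leB_anti.
  by apply: idem_max; [apply: borel_image | apply: borel_regressive].
rewrite -(borel_fix fB ff (idem_image _ u)).
by apply: biHecke_leB => //; apply: borel_regressive (idem_borel _).
Qed.

Lemma idem_mul_fix f w : borel_pred f -> f w = w -> idem w * f = idem w.
Proof.
move=> fB fw; apply/ffunP => u; rewrite transfME.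
exact: borel_fix (idem_image w u).
Qed.

Lemma mul_idem_fix f w : borel_pred f -> f w = w -> f * idem w = idem w.
Proof.
move=> fB fw; apply/ffunP => u; rewrite transfME; apply: leB_anti.
  by apply: biHecke_leB (idem_biHecke w) (borel_regressive u fB).
apply: idem_max (idem_image w u) _; rewrite -(borel_fix fB fw (idem_image w u)).
by apply: biHecke_leB (borel_biHecke fB) (borel_regressive u (idem_borel w)).
Qed.

Lemma mul_idem_image f : f \in biHecke W -> f * idem (f w0) = f.
Proof.
move=> fH; apply/ffunP => u; rewrite transfME; apply/eqP; rewrite idem_fix.
exact: borel_image.
Qed.

(** The values of e_x are exactly the a in [1,x]_L. For such an a, the largest admissible c is
    e_z(a) and the largest candidate in [1,y]_L is e_y(a), so only e_z(a) <=_B e_y(a) has to be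
    tested. *)
Lemma intermediateP x z y :
  reflect (idem x * idem y * idem z = idem x * idem z) (intermediate x z y).
Proof.
apply: (iffP forall_inP) => [yP|e a].
  apply/ffunP => u; rewrite !transfME; set a := idem x u; apply: leB_anti.
by apply: biHecke_leB (idem_biHecke z) (borel_regressive a (idem_borel y)).
  have ca : leB (idem z a) a := borel_regressive a (idem_borel z).
  have aL : a \in intvL 1 x by rewrite inE le1L idem_image.
  have cL : idem z a \in intvL 1 z by rewrite inE le1L idem_image.
  have /forall_inP/(_ _ cL) := yP _ aL; rewrite ca => /set0Pn[b].
  rewrite !inE => /andP[/andP[_ bL] /andP[cb ba]].
  apply: idem_max (idem_image z a) _; apply: leB_trans cb _; exact: idem_max.
rewrite inE => /andP[_ ax]; apply/forall_inP => c; rewrite inE => /andP[_ cz].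
apply/implyP => ca; apply/set0Pn; exists (idem y a).
rewrite !inE le1L idem_image (borel_regressive _ (idem_borel y)) /= andbT.
apply: leB_trans (idem_max cz ca) _.
move: (ax); rewrite -idem_fix => /eqP <-; rewrite -!transfME -e !transfME.
exact: borel_regressive (idem_borel z).
Qed.

(** Otherwise y = e_w(f x) would be a non-trivial intermediate factor: f x <> x gives y <_B x, and z
    <=_L y is excluded because y <=_L w. *)
Lemma quiver_pair_no_factor x z f w : quiver_pair x z -> borel_pred f ->
  f x != x -> ~~ leL z w -> idem x * f * idem w * idem z <> idem x * idem z.
Proof.
case/and3P => zx _ /existsPn/(_ (idem w (f x))) nint fB fx zw eq.
set y := idem w (f x) in nint; case/negP: nint; have [_ zxB] := andP zx.
have yw : leL y w := idem_image _ _.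
have eB := idem_borel; have eH := idem_biHecke.
have yE : y = (idem x * f * idem w) w0 by rewrite !transfME idem_w0.
have ey : idem x * f * idem w * idem y = idem x * f * idem w.
  by rewrite yE mul_idem_image // !biHeckeM ?borel_biHecke.
have zE : z = idem z y.
  have eqz : (idem x * idem z) w0 = z.
    rewrite transfME idem_w0; apply/leB_anti; first exact/leL_leB/idem_image.
    by apply: idem_max (leL_refl z) zxB.
  by rewrite -{1}eqz -eq !transfME idem_w0.
have yfx : leB y (f x) := borel_regressive _ (eB w).
apply/and4P; split.
- apply/intermediateP/ffunP => u; apply: leB_anti.
    by rewrite !transfME; apply: biHecke_leB (eH z) (borel_regressive _ (eB y)).
  (* The product e_x f e_w absorbs e_y, so e_x e_z = e_x f e_w e_y e_z. Dropping the regressive f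
     and e_w can only raise the value. *)
  rewrite -eq -ey !transfME; do 2!apply: biHecke_leB (eH _) _.
  by apply: leB_trans (borel_regressive _ (eB w)) (borel_regressive _ fB).
- rewrite /ltB (leB_trans yfx) ?borel_regressive // andbT.
  apply: contraNneq fx => yx; apply/eqP/leB_anti; first exact: borel_regressive.
  by rewrite -{1}yx.
- rewrite /ltB {2}zE borel_regressive ?andbT //.
  by apply: contraNneq zw => ->.
- by apply: contra zw => /andP[_ zy]; apply: leL_trans yw.
Qed.

(** * Generation of the Borel submonoid by the idempotents *)

Lemma piw_red r u v : word_val r = u -> size r = len u ->
  len (v * u) = (len v + len u)%N -> piw r v = v * u.
Proof. by move=> <- <-; apply: piw_up. Qed.

Lemma pibw_red r u v : word_val r = u -> size r = len u ->
  len v = (len (v * u^-1) + len u)%N -> pibw (rev r) v = v * u^-1.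
Proof. by move=> <- <-; rewrite -word_val_rev -(size_rev r); apply: pibw_down. Qed.

(** Since h v is left-above h 1, it has a reduced word ending in r; the first map applied strips r
    and the second restores it. *)
Lemma pibw_piw_image h r v : h \in biHecke W ->
  word_val r = h 1 -> size r = len (h 1) -> piw r (pibw (rev r) (h v)) = h v.
Proof.
move=> hH er sz; have /eqP le := biHecke_leL hH (le1L v).
rewrite (pibw_red er sz) 1?addnC // (piw_red er sz) ?mulgVK //.
by rewrite addnC.
Qed.

Definition egen f := exists ws : seq W, f = \prod_(w <- ws) idem w.

Lemma egenM f h : egen f -> egen h -> egen (f * h).
Proof. by move=> [w1 ->] [w2 ->]; exists (w1 ++ w2); rewrite big_cat. Qed.

(** The new factor [piw r' * k * pibw (rev r)] fixes 1, and the last equation makes it fix its image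
    of w0, so [idem_uniq] turns it into a single idempotent. *)
Lemma biHecke_egen_step h k r r' : h \in biHecke W -> k \in biHecke W ->
  word_val r' = h 1 -> size r' = len (h 1) ->
  word_val r = k (h 1) -> size r = len (k (h 1)) ->
  k (piw r' (pibw (rev r) (k w0))) = k w0 ->
  egen (h * pibw (rev r')) -> egen (h * k * pibw (rev r)).
Proof.
move=> hH kH er' sz' er sz eq hgen.
have -> : h * k * pibw (rev r) =
    h * pibw (rev r') * (piw r' * k * pibw (rev r)).
  by apply/ffunP => u; rewrite !transfME pibw_piw_image.
apply: egenM hgen _; exists [:: pibw (rev r) (k w0)]; rewrite big_seq1.
set f := piw r' * k * pibw (rev r).
have fw0 : f w0 = pibw (rev r) (k w0) by rewrite !transfME piw_w0.
have fH : f \in biHecke W.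
  by apply: biHeckeM (pibw_biHecke _); apply: biHeckeM kH; apply: piw_biHecke.
rewrite -fw0; apply: idem_uniq; last by rewrite fw0 !transfME eq.
rewrite /borel_pred fH !transfME (piw_red er' sz') ?mul1g ?len1 //=.
by rewrite (pibw_red er sz) mulgV ?len1.
Qed.

(** Prefixes of a product of generators need not fix 1. Composing with the descent along a reduced
    word of h 1 brings 1 back, so the induction can run over all of M(W); on M_1 the correction is
    empty. *)
Lemma biHecke_egen h : h \in biHecke W -> forall r,
  word_val r = h 1 -> size r = len (h 1) -> egen (h * pibw (rev r)).
Proof.
have lw u : len w0 = (len (w0 * u^-1) + len u)%N by rewrite addnC len_w0_mulV.
have w0i i : len w0 = (len (w0 * s i)).+1.
  by have := descR_w0 i; case: genP.
have wi i u : w0 * s i * u^-1 = w0 * (u * s i)^-1.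
  by rewrite cox_invM cox_genV cox_mulA.
elim/biHecke_rev_ind => [r|f i fH IH r|f i fH IH r].
- rewrite transf1E len1 => _ /size0nil->; exists [::].
  by rewrite pibw_nil mulg1 big_nil.
- have [er' sz'] := redwordP (f 1); rewrite transfME => er sz.
  apply: (biHecke_egen_step fH (biHecke_pi i) er' sz' er sz); last exact: IH.
  rewrite [pi_gen i w0]pi_genE descR_w0 (pibw_red er sz) ?lw //.
  rewrite [pi_gen i (f 1)]pi_genE; case: genP => e.
    by rewrite (piw_red er' sz') mulgVK // pi_genE descR_w0.
  have e2 : w0 * (f 1 * s i)^-1 * f 1 = w0 * s i by rewrite -wi mulgVK.
  rewrite (piw_red er' sz') e2; first by rewrite pi_genE descR_genM descR_w0 mul_genK.
  by apply: succn_inj; rewrite -w0i -addnS -e -lw.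
- have [er' sz'] := redwordP (f 1); rewrite transfME => er sz.
  apply: (biHecke_egen_step fH (biHecke_pib i) er' sz' er sz); last exact: IH.
  rewrite [pib_gen i w0]pib_genE descR_w0.
  move: er sz; rewrite [pib_gen i (f 1)]pib_genE; case: genP => e er sz.
    have e1 : w0 * s i * (f 1 * s i)^-1 = w0 * (f 1)^-1 by rewrite wi mul_genK.
    rewrite (pibw_red er sz) e1; last by apply: succn_inj; rewrite -w0i -addnS -e -lw.
    by rewrite (piw_red er' sz') mulgVK // pib_genE descR_w0.
  rewrite (pibw_red er sz) wi;
    last by apply: succn_inj; rewrite -w0i -addnS -e -lw.
  have e2 : w0 * (f 1 * s i)^-1 * f 1 = w0 * s i by rewrite -wi mulgVK.
  rewrite (piw_red er' sz') e2; first by rewrite pib_genE descR_genM descR_w0.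
  by apply: succn_inj; rewrite -w0i -addnS -e -lw.
Qed.

Lemma borel_ind (P : transf W -> Prop) : P 1 ->
  (forall f w, borel_pred f -> P f -> P (f * idem w)) ->
  forall f, borel_pred f -> P f.
Proof.
move=> P1 PM f fB; have fH := borel_biHecke fB; have f1 := borel_at1 fB.
have [||ws] := biHecke_egen fH (r := [::]); rewrite ?f1 ?word_val_nil ?len1 //.
rewrite pibw_nil mulg1 => ->.
suff [] : borel_pred (\prod_(w <- ws) idem w) /\ P (\prod_(w <- ws) idem w) by [].
elim/last_ind: ws => [|ws w [IH1 IH2]].
  by rewrite big_nil; case: (borel_closed W).
rewrite -cats1 big_cat big_seq1; split; last exact: PM.
exact: borelM (idem_borel w).
Qed.

End BiHeckeTheory.

(** * The algebra of the Borel submonoid *)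

Local Open Scope ring_scope.

Lemma amullE (F : fieldType) (B : falgType F) (a b : B) : amull a b = a * b.
Proof. by rewrite lfunE. Qed.

Lemma amulrE (F : fieldType) (B : falgType F) (a b : B) : amulr a b = b * a.
Proof. by rewrite lfunE. Qed.

Section AlgebraTheory.
Variables (W : coxeterGroup) (K : fieldType).
Local Notation G := (borel W).
Local Notation A := (borel_alg K W).
Local Notation chi := (@simple_char W K).
Local Notation mon := (mon K).
Implicit Types (u v w x y z : W) (f g h : G) (a b c : A).

Definition eb w : G := Borel (idem_borel w).

Lemma borel_valM f g : borel_val (f * g)%g = (borel_val f * borel_val g)%g.
Proof. by []. Qed.

Lemma borelP f : borel_pred f. Proof. exact: valP f. Qed.

Lemma borel_val_inj f g : borel_val f = borel_val g -> f = g.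
Proof. exact: val_inj. Qed.

Lemma borel_gen_ind (P : G -> Prop) : P 1%g ->
  (forall f w, P f -> P (f * eb w)%g) -> forall f, P f.
Proof.
move=> P1 PM f.
suff: forall h (hB : borel_pred h), P (Borel hB).
  by move=> /(_ f (borelP f)); congr P; apply: borel_val_inj.
move=> h hB; pose Q k := forall kB : borel_pred k, P (Borel kB).
suff: Q h by apply.
apply: (borel_ind (P := Q)) hB => [|k w kB IH] hB; rewrite ?/Q.
  by congr P: P1; apply: borel_val_inj.
by congr P: (PM (Borel kB) w (IH kB)); apply: borel_val_inj.
Qed.

Lemma algM a b h : (a * b) h = \sum_(f : G) \sum_(g : G | (f * g)%g == h) a f * b g.
Proof. exact: ffunE. Qed.

Lemma monM f g : mon (f * g)%g = mon f * mon g.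
Proof.
apply/ffunP => h; rewrite algM ffunE (bigD1 f) //= [X in _ + X]big1 ?addr0.
  rewrite big_mkcond (bigD1 g) //= [X in _ + X]big1 ?addr0.
    by rewrite !ffunE !eqxx mulr1 eq_sym; case: eqP.
  by move=> k /negPf kg; rewrite !ffunE kg mulr0 if_same.
by move=> k /negPf kf; rewrite big1 // => l _; rewrite ffunE kf mul0r.
Qed.

Lemma mon1 : mon (1%g : G) = 1 :> A. Proof. by []. Qed.

Lemma alg_ind (P : A -> Prop) : P 0 ->
  (forall k f a, P a -> P (k *: mon f + a)) -> forall a, P a.
Proof.
move=> P0 PD a; have -> : a = \sum_f a f *: mon f.
  apply/ffunP => h; rewrite sum_ffunE (bigD1 h) //= big1 => [|f /negPf fh].
    by rewrite !ffunE eqxx addr0 [_ *: _]mulr1.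
  by rewrite !ffunE eq_sym fh scaler0.
by elim/big_rec: _ => [|f b _ Pb] //; apply: PD.
Qed.

Lemma chi_is_linear w : linear_for *%R (chi w).
Proof.
move=> k a b; rewrite /simple_char mulr_sumr -big_split /=.
by apply: eq_bigr => f _; rewrite !ffunE.
Qed.

HB.instance Definition _ w :=
  GRing.isLinear.Build K A K *%R (chi w) (chi_is_linear w).

Lemma chi_mon w f : chi w (mon f) = (borel_val f w == w)%:R.
Proof.
rewrite /simple_char big_mkcond (bigD1 f) //= big1 ?addr0 => [|g /negPf gf].
  by rewrite ffunE eqxx; case: eqP.
by rewrite ffunE gf if_same.
Qed.

(** Both maps are regressive, so once w is lowered it cannot be recovered. This makes chi_w
    multiplicative. *)
Lemma borel_mul_fix f g w :
  (borel_val (f * g)%g w == w) = (borel_val f w == w) && (borel_val g w == w).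
Proof.
rewrite borel_valM transfME; apply/eqP/andP => [e|[/eqP-> /eqP->//]].
have fw : borel_val f w = w.
  apply: leB_anti; first exact/borel_regressive/borelP.
  by rewrite -{1}e; apply/borel_regressive/borelP.
by rewrite -{4}e fw !eqxx.
Qed.

Lemma chiM w a b : chi w (a * b) = chi w a * chi w b.
Proof.
elim/alg_ind: a => [|k f a IHa]; first by rewrite mul0r !linear0 mul0r.
rewrite mulrDl linearD linearP /= mulrDl IHa; congr (_ + _).
rewrite -scalerAl linearZ /= -mulrA; congr (_ * _).
elim/alg_ind: b {IHa} => [|l g b IHb]; first by rewrite mulr0 !linear0 mulr0.
rewrite mulrDr linearD linearP /= mulrDr IHb; congr (_ + _).
rewrite -scalerAr linearZ /= mulrCA; congr (_ * _).
by rewrite -monM !chi_mon borel_mul_fix; do 2!case: (_ == w); rewrite ?mulr0 ?mulr1.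
Qed.

Lemma chi1 w : chi w 1 = 1.
Proof. by rewrite -mon1 chi_mon transf1E eqxx. Qed.

Lemma chi_eb w v : chi w (mon (eb v)) = (leL w v)%:R.
Proof. by rewrite chi_mon /= idem_fix. Qed.

(** * The Jacobson radical as the common kernel of the characters *)

Local Notation J := (jacobson A).

Definition borel_height f : nat := (\sum_(w : W) len (borel_val f w))%N.

Lemma borel_height_mul f g :
  (f * g)%g != f -> (borel_height (f * g)%g < borel_height f)%N.
Proof.
move=> fg; rewrite /borel_height.
have [w fgw] : exists w, borel_val (f * g)%g w != borel_val f w.
  apply/existsP; apply: contraNT fg => /existsPn e; apply/eqP/borel_val_inj/ffunP => w.
  by apply/eqP; have := e w; rewrite negbK.
have le v : leB (borel_val (f * g)%g v) (borel_val f v).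
  by rewrite borel_valM transfME; apply/borel_regressive/borelP.
rewrite (bigD1 w) // [ltnRHS](bigD1 w) //= -addSn leq_add //.
  by case/leB_len: (le w) => // e; rewrite e eqxx in fgw.
by apply: leq_sum => v _; apply/leB_len_le/le.
Qed.

(** The image of f lies left-below f w0, and the fixed points of g are closed downwards in left
    order. *)
Lemma borel_mul_id f g :
  ((f * g)%g == f) = (borel_val g (borel_val f (w0 W)) == borel_val f (w0 W)).
Proof.
apply/eqP/eqP => [{2}<-|e]; first by rewrite borel_valM transfME.
apply/borel_val_inj/ffunP => u; rewrite borel_valM transfME.
apply: borel_fix (borelP g) e _; apply: borel_image.
exact/borel_biHecke/borelP.
Qed.

(** Right multiplication by a is strictly triangular for [borel_height]: in the coefficient at h,
    the terms with f = h add up to a multiple of chi a at the element h w0, and all others have f of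
    larger height. *)
Lemma chi0_nilpotent a : (forall w, chi w a = 0) -> exists n, a ^+ n = 0.
Proof.
move=> a0; pose m := \max_(f : G) borel_height f.
have supp n f : (a ^+ n) f != 0 -> (borel_height f + n <= m)%N.
  elim: n f => [|n IH] h; first by rewrite addn0 leq_bigmax.
  apply: contraNT => nle; rewrite exprSr algM big1 // => f _.
  have [hf|hf] := eqVneq h f.
    subst h; have := a0 (borel_val f (w0 W)); rewrite /simple_char => e.
    rewrite -mulr_sumr (eq_bigl _ _ (fun g => borel_mul_id f g)) e mulr0 //.
  have [->|/IH le] := eqVneq ((a ^+ n) f) 0.
    by rewrite big1 // => g _; rewrite mul0r.
  rewrite big_pred0 // => g; apply: contraNF nle => /eqP e.
  have := @borel_height_mul f g; rewrite e => /(_ hf); lia.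
have le_m f : (borel_height f <= m)%N by exact: leq_bigmax.
exists m.+1; apply/ffunP => f; rewrite [RHS]ffunE.
by have [//|/supp] := eqVneq ((a ^+ m.+1) f) 0; lia.
Qed.

(** The kernel of chi_w has codimension one, hence is a maximal right ideal. Conversely, if a is
    outside a maximal m, then 1 = b + a c with b in m; as a c is nilpotent, a geometric series
    inverts b. *)
Lemma mem_jacobson a : a \in J <-> forall w, chi w a = 0.
Proof.
rewrite /jacobson; case: (cid _) => J' /= J'P; split=> [/J'P aJ w|a0].
  pose k := linfun (chi w : A -> K^o).
  have kE b : (b \in lker k) = (chi w b == 0) by rewrite memv_ker lfunE.
  apply/eqP; rewrite -kE; apply: aJ; split.
  - apply/prodvP => b c; rewrite !kE => /eqP b0 _.
    by rewrite chiM b0 mul0r.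
  - apply/eqP => e; have : (1 : A) \in lker k by rewrite e memvf.
    by rewrite kE chi1 oner_eq0.
  - move=> m /prodvP mr km.
    have [km'|/subvPn[b bm]] := boolP (m <= lker k)%VS.
      by left; apply/eqP; rewrite eqEsubv km km'.
    rewrite kE => b0; right; apply/eqP; rewrite eqEsubv subvf /=.
    apply/subvP => c _.
    have -> : c = (c - (chi w c / chi w b) *: b) + b * ((chi w c / chi w b)%:A).
      by rewrite -scalerAr mulr1 subrK.
    rewrite memvD ?mr ?memvf //; apply: (subvP km).
    by rewrite kE linearB linearZ /= divfK ?subrr.
apply/J'P => m [/prodvP mr mf mmax]; apply: contraNT mf => am.
pose aA := limg (amull a).
have aAE b : a * b \in aA by rewrite -amullE memv_img ?memvf.
have mr' : right_ideal (m + aA)%VS.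
  apply/prodvP => b c /memv_addP[b1 b1m [_ /memv_imgP[d _ ->] ->]] _.
  by rewrite amullE mulrDl -mulrA memv_add ?mr ?memvf.
case: (mmax _ mr' (addvSl _ _)) => e.
  by case/negP: am; rewrite -e -[a]mulr1; apply: (subvP (addvSr _ _)).
have : (1 : A) \in (m + aA)%VS by rewrite e memvf.
case/memv_addP => b bm [_ /memv_imgP[c _ ->]]; rewrite amullE => e1.
have [|n ac0] := @chi0_nilpotent (a * c); first by move=> w; rewrite chiM a0 mul0r.
rewrite eqEsubv subvf; apply/subvP => d _.
suff m1 : 1 \in m by rewrite -[d]mul1r mr ?memvf.
have -> : 1 = b * \sum_(i < n) (a * c) ^+ i.
  have -> : b = 1 - a * c by rewrite e1 addrK.
  by rewrite -opprB mulNr -subrX1 ac0 sub0r opprK.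
exact: mr bm (memvf _).
Qed.


Lemma corresponds_chi w e : corresponds_to w e ->
  e * e = e /\ forall v, chi v e = (v == w)%:R.
Proof.
case=> -[_ ee _] [phi [phiM phi0 phiK]]; split=> // v.
have [->|vw] := eqVneq v w.
  have := phiM 1 e; rewrite mulr1 ee => /eqP.
  by rewrite -subr_eq0 -{1}[phi e]mulr1 -mulrBr mulf_eq0 (negPf phi0) subr_eq0 => /eqP.
(* A separating element is e_v, or 1 - e_w if w <=_L v. Then e a is in the radical, which forces
   chi_v e = 0. *)
have [a aw av] : exists2 a, chi w a = 0 & chi v a = 1.
  have [vLw|vLw] := boolP (leL w v); last first.
    by exists (mon (eb v)); rewrite chi_eb ?leL_refl // (negPf vLw).
  exists (1 - mon (eb w)); rewrite linearB /= chi1 chi_eb ?leL_refl ?subrr //.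
  case: (boolP (leL v w)) => [wv|]; last by rewrite subr0.
  by rewrite (leL_anti wv vLw) eqxx in vw.
have /phiK : phi (e * a) = 0 by rewrite -[e]mulr1 phiM aw mulr0.
have eJ : (<[e]> * J <= J)%VS.
  by apply/prodvP => b c _ /mem_jacobson cJ; apply/mem_jacobson => u; rewrite chiM cJ mulr0.
by move/(subvP eJ)/mem_jacobson/(_ v); rewrite chiM av mulr1.
Qed.

(** * Derivations twisted by two characters *)

Section Derivation.
Variables (V : vectType K) (x z : W) (D : A -> V).
Hypothesis Dlin : forall k a b, D (k *: a + b) = k *: D a + D b.
Hypothesis DM : forall a b, D (a * b) = chi x a *: D b + chi z b *: D a.

Lemma derivation_mem (U : {vspace V}) :
  (forall w, D (mon (eb w)) \in U) -> forall a, D a \in U.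
Proof.
move=> DU; apply: alg_ind => [|k f a Da].
  by rewrite -[0](addNr 0) -scaleN1r Dlin scaleN1r addNr mem0v.
rewrite Dlin memvD ?memvZ //; elim/borel_gen_ind: f => [|f w IH].
  rewrite mon1; have := DM 1 1; rewrite mulr1 !chi1 !scale1r => /eqP.
  by rewrite -subr_eq0 opprD addNKr oppr_eq0 => /eqP->; rewrite mem0v.
by rewrite monM DM memvD ?memvZ.
Qed.

Local Notation d w := (D (mon (eb w))).

Lemma mon_idem_mul w v : leL w v ->
  mon (eb w) * mon (eb v) = mon (eb w) /\ mon (eb v) * mon (eb w) = mon (eb w).
Proof.
rewrite -idem_fix => /eqP vw; rewrite -!monM.
by split; congr mon; apply: borel_val_inj;
  [apply: idem_mul_fix | apply: mul_idem_fix] => //; apply: idem_borel.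
Qed.

Lemma deriv_fst w : leL x w -> ~~ leL z w -> d w = d x.
Proof.
move=> xw zw; have [e _] := mon_idem_mul xw.
by rewrite -[in RHS]e DM !chi_eb leL_refl (negPf zw) scale1r scale0r addr0.
Qed.

Lemma deriv_snd w : ~~ leL x w -> leL z w -> d w = d z.
Proof.
move=> xw zw; have [_ e] := mon_idem_mul zw.
by rewrite -[in RHS]e DM !chi_eb leL_refl (negPf xw) scale1r scale0r add0r.
Qed.

Lemma deriv_eq0 w : leL x w = leL z w -> d w = 0.
Proof.
move=> xz; have [e _] := mon_idem_mul (leL_refl w).
have : d w = d w *+ (leL x w).*2.
  by rewrite -{1}e DM !chi_eb -xz !scaler_nat -mulrnDr addnn.
case: (leL x w) => // /eqP.
by rewrite -subr_eq0 mulr2n opprD addNKr oppr_eq0 => /eqP.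
Qed.

Lemma deriv_mon_mul v w : D (mon (eb v * eb w)%g) =
  d w *+ leL x v + d v *+ leL z w.
Proof. by rewrite monM DM !chi_eb !scaler_nat. Qed.

End Derivation.

Section DerivationRadical.
Variables (V : vectType K) (x z : W) (D : A -> V).
Hypothesis Dlin : forall k a b, D (k *: a + b) = k *: D a + D b.
Hypothesis DM : forall a b, D (a * b) = chi x a *: D b + chi z b *: D a.
Local Notation d w := (D (mon (eb w))).

(* Subtracting an inner derivation does not change [D] on the radical. *)
Lemma deriv_rad_mem (U : {vspace V}) (c : V) :
  (forall w, d w - ((leL x w)%:R - (leL z w)%:R) *: c \in U) ->
  forall a, chi x a = chi z a -> D a \in U.
Proof.
move=> DU a xza; pose D0 b := D b - (chi x b - chi z b) *: c.
suff: D0 a \in U by rewrite /D0 xza subrr scale0r subr0.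
apply: (@derivation_mem V x z) => [k b b'|b b'|w].
- rewrite /D0 Dlin !linearP /= scalerBr scalerA addrACA -opprD -scalerDl.
  by congr (_ - _ *: c); ring.
- rewrite /D0 DM !chiM !scalerBr !scalerA addrACA -opprD -scalerDl.
  by congr (_ - _ *: c); ring.
- by rewrite /D0 !chi_eb; apply: DU.
Qed.

(** If x and z are left-comparable, only one of the values D(e_x), D(e_z) occurs among the non-zero
    D(e_w), and one inner derivation removes it. *)
Lemma deriv_vanish : leL z x || leL x z ->
  forall a, chi x a = chi z a -> D a = 0.
Proof.
have mem0 (c : V) : (forall w, d w - ((leL x w)%:R - (leL z w)%:R) *: c = 0) ->
    forall a, chi x a = chi z a -> D a = 0.
  move=> e a xza; apply/eqP; rewrite -memv0.
  by apply: (deriv_rad_mem (c := c)) xza => w; rewrite e mem0v.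
case/orP => le.
  apply: (mem0 (- d z)) => w; case: (boolP (leL x w)) => xw.
    by rewrite (leL_trans le xw) subrr scale0r subr0 (deriv_eq0 DM) // xw (leL_trans le xw).
  case: (boolP (leL z w)) => zw; last first.
    by rewrite subrr scale0r subr0 (deriv_eq0 DM) // (negPf xw) (negPf zw).
  by rewrite (deriv_snd DM xw zw) sub0r scaleN1r opprK subrr.
apply: (mem0 (d x)) => w; case: (boolP (leL z w)) => zw.
  by rewrite (leL_trans le zw) subrr scale0r subr0 (deriv_eq0 DM) // zw (leL_trans le zw).
case: (boolP (leL x w)) => xw; last first.
  by rewrite subrr scale0r subr0 (deriv_eq0 DM) // (negPf xw) (negPf zw).
by rewrite (deriv_fst DM xw zw) subr0 scale1r subrr.
Qed.

Lemma deriv_span : ~~ leL z x -> ~~ leL x z ->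
  forall a, chi x a = chi z a -> D a \in <[D (mon (eb x * eb z)%g)]>%VS.
Proof.
(* This choice cancels the value at each w above x only; at w above z only, d z + d x remains, which
   is D(e_x e_z). *)
move=> zx xz; apply: (deriv_rad_mem (c := d x)) => w.
rewrite (deriv_mon_mul DM) !leL_refl !mulr1n.
case: (boolP (leL x w)) => xw; case: (boolP (leL z w)) => zw.
- by rewrite (deriv_eq0 DM) ?xw // subrr scale0r subr0 mem0v.
- by rewrite (deriv_fst DM xw zw) subr0 scale1r subrr mem0v.
- by rewrite (deriv_snd DM xw zw) sub0r scaleN1r opprK memv_line.
- by rewrite (deriv_eq0 DM) ?(negPf xw) ?(negPf zw) // subrr scale0r subr0 mem0v.
Qed.

Lemma deriv_rad a : chi x a = chi z a ->
  D a \in (if quiver_pair x z then <[D (mon (eb x * eb z)%g)]> else 0)%VS.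
Proof.
move=> xza.
have [le|] := boolP (leL z x || leL x z).
  by rewrite (deriv_vanish le xza) mem0v.
rewrite negb_or => /andP[zx xz]; have Da := deriv_span zx xz xza.
case: ifPn => // nq; suff e : D (mon (eb x * eb z)%g) = 0 by rewrite e in Da *.
have qx : chi x (mon (eb x * eb z)%g) = 0.
  by rewrite monM chiM !chi_eb (negPf xz) mulr0.
have [zxB|zxB] := boolP (ltB z x); last first.
  (* As e_x e_z sends w0 to t, it absorbs e_t. Here t <> z since z is not Bruhat-below x, so
     chi_z(e_t) = 0 and the product rule gives zero. *)
  pose t := idem z x.
  have qt : (eb x * eb z = eb x * eb z * eb t)%g.
    apply/borel_val_inj; rewrite !borel_valM /=.
    have <- : (idem x * idem z)%g (w0 W) = t by rewrite transfME idem_w0.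
    by rewrite mul_idem_image // biHeckeM ?idem_biHecke.
  rewrite qt monM DM qx scale0r add0r chi_eb.
  case: (boolP (leL z t)) => zt; last by rewrite scale0r.
  case/negP: zxB; rewrite /ltB (contraNneq _ zx) => [|->]; last exact: leL_refl.
  by rewrite (leL_anti zt (idem_image _ _)) borel_regressive ?idem_borel.
have /existsP[y /and4P[/intermediateP yq yx zy zyL]] :
    [exists y, nontrivial_intermediate x z y].
  by move: nq; rewrite /quiver_pair zxB /ltL (negPf zx) andbF negbK.
(* Neither x nor z is left-below y, so both characters and D vanish at e_y, and no term of the
   product rule survives. *)
have -> : (eb x * eb z = eb x * eb y * eb z)%g.
  by apply/borel_val_inj; rewrite !borel_valM /= yq.
have xy : leL x y = false.
  apply/negP => /leL_leB/(leB_anti (proj2 (andP yx))) e.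
  by rewrite /ltB e eqxx in yx.
have zy' : leL z y = false.
  by apply: contraNF zyL => zyL; rewrite /ltL zyL andbT; case/andP: zy.
rewrite monM DM monM chiM !chi_eb xy mulr0 scale0r add0r -monM (deriv_mon_mul DM).
by rewrite zy' (deriv_eq0 DM) ?xy ?zy' // mul0rn addr0 scaler0.
Qed.
End DerivationRadical.

(** * A derivation detecting the arrow of a quiver pair *)

Section QuiverForm.
Variables (x z : W).
Hypothesis xzP : quiver_pair x z.

Definition quiver_coef f : K :=
  ((idem x * borel_val f * idem z == idem x * idem z)%g &&
   (borel_val f x != x))%:R.

Lemma quiver_pair_ltB : ltB z x. Proof. by case/and3P: xzP. Qed.

Lemma quiver_pair_leL : ~~ leL z x /\ ~~ leL x z.
Proof.
case/and3P: xzP => /andP[zx zxB] nL _; rewrite /ltL zx in nL; split=> //.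
by apply: contraNN zx => /leL_leB/leB_anti->.
Qed.

(** It suffices to take g = e_w. If f fixes x, then e_x f = e_x; if z <=_L w, then e_w e_z = e_z;
    otherwise [quiver_pair_no_factor] makes the left side zero. *)
Lemma quiver_coefM f g :
  quiver_coef (f * g)%g =
    chi x (mon f) * quiver_coef g + chi z (mon g) * quiver_coef f.
Proof.
elim/borel_gen_ind: g f => [f|g w IH f].
  rewrite mulg1 mon1 chi1 mul1r [quiver_coef 1%g]/quiver_coef transf1E eqxx andbF.
  by rewrite mulr0 add0r.
rewrite mulgA; have gen h : quiver_coef (h * eb w)%g =
    chi x (mon h) * quiver_coef (eb w) + chi z (mon (eb w)) * quiver_coef h.
  rewrite chi_mon chi_eb /quiver_coef; have [hx|hx] := eqVneq (borel_val h x) x.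
    rewrite andbF mul1r mulr0 addr0 borel_valM transfME hx mulgA.
    by rewrite (idem_mul_fix (borelP h) hx).
  rewrite mul0r add0r andbT.
  have -> : borel_val (h * eb w)%g x != x.
    by rewrite borel_mul_fix (negPf hx).
  rewrite andbT borel_valM mulgA /=.
  have [zw|zw] := boolP (leL z w).
    rewrite mul1r -[(_ * idem w * idem z)%g]mulgA.
    by rewrite (mul_idem_fix (idem_borel w)) //; apply/eqP; rewrite idem_fix.
  rewrite mul0r; case: eqP => // e.
  by case: (quiver_pair_no_factor xzP (borelP h) hx zw).
rewrite (gen (f * g)%g) (gen g) IH !monM !chiM; ring.
Qed.

Definition quiver_form a : K^o := \sum_(f : G) a f * quiver_coef f.

Lemma quiver_form_is_linear : linear quiver_form.
Proof.
move=> k a b; rewrite /quiver_form scaler_sumr -big_split /=.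
by apply: eq_bigr => f _; rewrite !ffunE mulrDl -mulrA.
Qed.

HB.instance Definition _ :=
  GRing.isLinear.Build K A K^o *:%R quiver_form quiver_form_is_linear.

Lemma quiver_form_mon f : quiver_form (mon f) = quiver_coef f.
Proof.
rewrite /quiver_form (bigD1 f) //= big1 ?addr0 => [|g /negPf gf].
  by rewrite ffunE eqxx mul1r.
by rewrite ffunE gf mul0r.
Qed.

Lemma quiver_formM a b :
  quiver_form (a * b) = chi x a * quiver_form b + chi z b * quiver_form a.
Proof.
elim/alg_ind: a => [|k f a IHa]; first by rewrite !(mul0r, linear0, mulr0, addr0).
rewrite mulrDl -scalerAl !linearP /= IHa.
suff -> : quiver_form (mon f * b) =
    chi x (mon f) * quiver_form b + chi z b * quiver_form (mon f).
  by rewrite /GRing.scale /=; ring.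
elim/alg_ind: b {IHa} => [|l g b IHb]; first by rewrite !(mul0r, linear0, mulr0, addr0).
rewrite mulrDr -scalerAr !linearP /= IHb -monM !quiver_form_mon quiver_coefM.
by rewrite /GRing.scale /=; ring.
Qed.

Lemma quiver_form_rad2 a : a \in (J * J)%VS -> quiver_form a = 0.
Proof.
suff /subvP le : (J * J <= lker (linfun quiver_form))%VS.
  by move/le; rewrite memv_ker lfunE => /eqP.
apply/prodvP => b c /mem_jacobson b0 /mem_jacobson c0.
by rewrite memv_ker lfunE /= quiver_formM b0 c0 !mul0r addr0.
Qed.

Lemma chi_q w : w = x \/ w = z -> chi w (mon (eb x * eb z)%g) = 0.
Proof.
have [zx xz] := quiver_pair_leL.
by rewrite monM chiM !chi_eb => -[]->; rewrite ?(negPf zx) ?(negPf xz) ?mulr0 ?mul0r.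
Qed.

Lemma quiver_form_q : quiver_form (mon (eb x * eb z)%g) = 1.
Proof.
rewrite quiver_form_mon /quiver_coef borel_mul_fix /= !idem_fix.
have [_ /negPf->] := quiver_pair_leL.
rewrite andbF /= !mulgA (idem_mul_fix (idem_borel x) (idem_self x)).
by rewrite -mulgA (idem_mul_fix (idem_borel z) (idem_self z)) eqxx.
Qed.

End QuiverForm.

(** The projection along U serves as the quotient map onto V / U. *)
Lemma vspace_mod_ex (V : vectType K) (U : {vspace V}) :
  exists p : 'End(V), forall v : V, (p v == 0) = (v \in U).
Proof.
exists (\1 - projv U)%VF => v; rewrite add_lfunE opp_lfunE id_lfunE subr_eq0.
by apply/eqP/idP => [->|/projv_id->]; rewrite ?memv_proj.
Qed.

(** * Counting the arrows *)

Section Arrows.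
Variables (x z : W) (e f : A).
Hypothesis (eP : corresponds_to x e) (fP : corresponds_to z f).

Let q := mon (eb x * eb z)%g.

Lemma arrow_corner_mem a : a \in J ->
  e * a * f \in ((if quiver_pair x z then <[e * q * f]> else 0) + J * J)%VS.
Proof.
have [ee chie] := corresponds_chi eP; have [ff chif] := corresponds_chi fP.
move=> /mem_jacobson a0; have [p pP] := vspace_mod_ex (J * J)%VS.
(* On J this is the class of e b f modulo J^2; the correction term yields the product rule on the
   whole algebra. *)
pose D b := p (e * b * f - chi x b *: (e * f)).
have Dlin k b c : D (k *: b + c) = k *: D b + D c.
  rewrite /D -linearP; congr (p _).
  rewrite mulrDr mulrDl linearP /= scalerDl -scalerAr -scalerAl.
  by rewrite scalerBr scalerA opprD addrACA.
have DM b c : D (b * c) = chi x b *: D c + chi z c *: D b.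
  apply/eqP; rewrite -subr_eq0 /D -!linearZ -linearD -linearB /= pP.
  (* The defect of the product rule is a product of two elements of J, because chi_w e and chi_w f
     vanish except at w = x and w = z respectively. *)
  have -> : e * (b * c) * f - chi x (b * c) *: (e * f) -
     (chi x b *: (e * c * f - chi x c *: (e * f)) +
      chi z c *: (e * b * f - chi x b *: (e * f))) =
     (e * b - chi x b *: e) * (c * f - chi z c *: f).
    rewrite chiM mulrBl !mulrBr -!scalerAl -!scalerAr !mulrA !scalerBr !scalerA.
    rewrite [chi z c * _]mulrC opprD !opprB !addrA subrK.
    by rewrite [LHS]addrAC [RHS]addrAC [X in X + _]addrAC.
  apply: memv_mul; apply/mem_jacobson => w; rewrite linearB linearZ /= chiM ?chie ?chif.
    by case: eqP => [->|_]; rewrite ?mul1r ?mulr1 ?mul0r ?mulr0 subrr.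
  by case: eqP => [->|_]; rewrite ?mulr1 ?mulr0 subrr.
have Da : D a = p (e * a * f) by rewrite /D a0 scale0r subr0.
have := deriv_rad Dlin DM (a := a); rewrite !a0 Da => /(_ erefl).
case: ifPn => xz.
  rewrite /D chi_q; [|done|by left].
  rewrite scale0r subr0 => /vlineP[k /eqP]; rewrite -linearZ -subr_eq0 -linearB /= pP => le.
  by rewrite -[e * a * f](subrKC (k *: (e * q * f))) memv_add ?memvZ ?memv_line.
by rewrite memv0 pP add0v.
Qed.

Lemma arrow_space_quiver :
  arrow_space e f = ((if quiver_pair x z then <[e * q * f]> else 0) + J * J)%VS.
Proof.
have [ee chie] := corresponds_chi eP; have [ff chif] := corresponds_chi fP.
apply/eqP; rewrite eqEsubv; apply/andP; split.
  rewrite /arrow_space subv_add addvSr andbT.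
  set U := (_ + _)%VS.
  have le : (<[e]> * J <= amulr f @^-1: U)%VS.
    apply/prodvP => _ a /vlineP[k ->] aJ.
    by rewrite -memv_preim amulrE -!scalerAl memvZ // arrow_corner_mem.
  apply/prodvP => b c /(subvP le); rewrite -memv_preim amulrE => bU /vlineP[k ->].
  by rewrite -scalerAr memvZ.
rewrite subv_add /arrow_space addvSr andbT; case: ifPn => xz; last exact: sub0v.
apply: subv_trans (addvSl _ _); rewrite -memvE.
have -> : e * q * f = e * (e * q * f) * f.
  by rewrite -!mulrA ff !mulrA ee.
apply: memv_mul (memv_line f); apply: memv_mul (memv_line e) _.
apply/mem_jacobson => w; rewrite !chiM chie chif.
case: eqP => [->|]; last by rewrite !mul0r.
case: eqP => [e1|]; last by rewrite mulr0.
by have := quiver_pair_ltB xz; rewrite /ltB e1 eqxx.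
Qed.

Lemma nb_arrows_quiver : nb_arrows e f = quiver_pair x z.
Proof.
have [ee chie] := corresponds_chi eP; have [ff chif] := corresponds_chi fP.
rewrite /nb_arrows arrow_space_quiver; case: ifPn => xz; last by rewrite add0v subnn.
(* The form kills J^2, so this value places e q f outside J^2 and the dimension grows by exactly
   one. *)
have form1 : quiver_form x z (e * q * f) = 1.
  rewrite !quiver_formM // chiM !chie chif !chi_q //; [|by right|by left].
  by rewrite !eqxx quiver_form_q // !(mulr0, mul0r, mul1r, mulr1, add0r, addr0).
have nJ : e * q * f \notin (J * J)%VS.
  by apply/negP => /(quiver_form_rad2 xz)/eqP; rewrite form1 oner_eq0.
rewrite dimv_disjoint_sum ?dim_vline ?addnK.
  by case: eqP nJ => // ->; rewrite mem0v.
apply/eqP; rewrite -subv0; apply/subvP => v; rewrite memv_cap => /andP[/vlineP[k ->]].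
by rewrite !rpredZeq (negPf nJ) orbF => ->.
Qed.

End Arrows.

End AlgebraTheory.

Theorem theorem5p15 (W : coxeterGroup) (K : fieldType)
    (charK0 : [pchar K] =i pred0)
    (eps : W -> borel_alg K W)
    (epsP : forall w, corresponds_to w (eps w)) :
  [/\ forall x z : W,
        nb_arrows (eps x) (eps z) = (if quiver_pair x z then 1%N else 0%N),
      forall x z : W, quiver_pair x z ->
        exists q : borel W,
          borel_val q = (e_ x * e_ z)%g /\
          (<[eps x * mon K q * eps z]> + jacobson (borel_alg K W) * jacobson (borel_alg K W)
             = arrow_space (eps x) (eps z))%VS,
      forall p : seq W,
        path.cycle (fun x z => (0 < nb_arrows (eps x) (eps z))%N) p -> p = [::]
    & forall x z : W, coverB x z -> ~~ coverL x z ->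
        nb_arrows (eps x) (eps z) = 1%N].
Proof.
have nbE x z : nb_arrows (eps x) (eps z) = (if quiver_pair x z then 1%N else 0%N).
  by rewrite (nb_arrows_quiver (epsP x) (epsP z)); case: ifP.
split=> // [x z xz|p|x z /andP[zx /existsPn nB] nL].
- exists (eb x * eb z)%g; split; first by rewrite borel_valM /= !idemE.
  by rewrite (arrow_space_quiver (epsP x) (epsP z)) xz.
- case: p => // x p cyc; suff: (len x < len x)%N by rewrite ltnn.
  have edge u v : (0 < nb_arrows (eps u) (eps v))%N -> (len v < len u)%N.
    by rewrite nbE; case: ifP => // uv _; apply/ltB_len/quiver_pair_ltB.
  have lenT : transitive (fun u v : W => (len v < len u)%N).
    by move=> v u w uv vw; apply: ltn_trans vw uv.
  have /allP/(_ x) := order_path_min lenT (sub_path edge cyc).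
  by rewrite mem_rcons mem_head; apply.
(* A non-trivial intermediate factor, or an element strictly between z and x in left order, would
   lie strictly between them in Bruhat order. *)
- rewrite nbE (_ : quiver_pair x z) //; apply/and3P; split=> //.
    apply: contra nL => zxL; rewrite /coverL zxL; apply/existsPn => y.
    apply: contra (nB y) => /andP[/andP[zy zyL] /andP[yx yxL]].
    by rewrite /ltB zy yx !leL_leB.
  apply/existsPn => y; apply: contra (nB y).
  by case/and4P => _ -> ->.
Qed.
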